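(* Let $X$ be a space of analytic functions on $\mathbb D$ that admits a Garsia-type norm $\mathcal N=\mathcal N_{p,\Psi,k}$ (as defined in the context), where $p\ge 1$ and $\Psi$ satisfies $\Psi(\mathbf 1,z)=1$ for all $z\in\mathbb D$, $\mathbf 1$ being the constant function $1$. Then there is a constant $c=c(X,p,\Psi,k)>0$ such that the following holds. Let $n\ge 1$ be an integer, let $f_0,\dots,f_{n+1}$ be functions analytic on (a neighborhood of) the closed disk $\mathbb D\cup\mathbb T$ with $f_{n+1}=f_0+\dots+f_n$, and assume that the Wronskian $W=W(f_0,\dots,f_n)$ vanishes nowhere on $\mathbb T$. For $0\le j\le n+1$ let $B_j$ be the finite Blaschke product associated with $f_j$, and put $$\mathbf B:=\mathrm{LCM}(B_0,\dots,B_{n+1}),\qquad \mathcal B:=\mathrm{rad}(B_0B_1\cdots B_{n+1}).$$ Then $$\mathcal N(\mathbf B)\le\gamma+\mu\, n^{1/p}\,\mathcal N(\mathcal B),$$ where $$\gamma:=\mathcal N(W)\,\|1/W\|_\infty,\qquad \mu:=\|W\|_\infty\,\|1/W\|_\infty,$$ and also $$c\,\|\mathbf B\|_X\le\kappa_X+\mu\, n^{1/p}\,\|\mathcal B\|_X,\qquad\text{where }\ \kappa_X:=\|W\|_X\,\|1/W\|_\infty .$$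
   Context: $\mathbb D=\{z\in\mathbb C:|z|<1\}$, $\mathbb T=\partial\mathbb D$, $\mathbb R_+=(0,\infty)$. $L^p(\mathbb T)$ is taken with respect to normalized arclength measure on $\mathbb T$, $\|\cdot\|_\infty=\|\cdot\|_{L^\infty(\mathbb T)}$, and $H^p$ is the Hardy space of the disk; functions in $H^p$ are identified on $\mathbb T$ with their boundary values. Wronskian: $W(f_0,\dots,f_n)=\det\big(f_j^{(i)}\big)_{0\le i,j\le n}$ (row $i$ consists of the $i$-th derivatives). Blaschke products: if $f_j$ has distinct zeros $a_1,\dots,a_s$ in the open disk $\mathbb D$ with multiplicities $m_1,\dots,m_s$, then $B_j(z)=\prod_{k=1}^s\left(\frac{z-a_k}{1-\overline{a_k}z}\right)^{m_k}$ (with $B_j=1$ if there are no zeros in $\mathbb D$). $\mathrm{LCM}(B_0,\dots,B_{n+1})$ is the least common multiple, i.e. the Blaschke product whose multiplicity at each point $a\in\mathbb D$ is the maximum of the multiplicities of $a$ as a zero of $B_0,\dots,B_{n+1}$. For a Blaschke product $B$, its radical $\mathrm{rad}(B)$ is the Blaschke product having the same distinct zeros as $B$, each with multiplicity one. Garsia-type norm: let $X$ be a Banach space of analytic functions on $\mathbb D$ with $X\subset H^p$ for some $p>0$ (the spaces in question are analytic subspaces of smoothness classes, and constant functions have zero $X$-norm, so $\|\cdot\|_X$ is in general a norm only modulo constants). Let $|H^p|$ be the set of all nonnegative functions $g\in L^p(\mathbb T)$ such that either $\log g\in L^1(\mathbb T)$ or $g=0$ a.e. Suppose there exist a mapping $\Psi:|H^p|\times\mathbb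 D\to[0,+\infty]$ and a function $k:\mathbb D\to\mathbb R_+$ such that: (1) $\Psi(\lambda g,z)=\lambda^p\Psi(g,z)$ for all $\lambda\in\mathbb R_+$, $g\in|H^p|$, $z\in\mathbb D$; (2) $\Psi(|f|,z)\ge|f(z)|^p$ for all $f\in H^p$, $z\in\mathbb D$ (here $|f|$ denotes the modulus of the boundary function on $\mathbb T$); (3) the quantity $$\mathcal N(f)=\mathcal N_{p,\Psi,k}(f):=\sup_{z\in\mathbb D}\frac{\{\Psi(|f|,z)-|f(z)|^p\}^{1/p}}{k(z)},\qquad f\in H^p,$$ is comparable to $\|f\|_X$, i.e. each is bounded by a constant multiple of the other with constants independent of $f\in H^p$, where $\|f\|_X:=\infty$ for $f\in H^p\setminus X$. Then $\mathcal N=\mathcal N_{p,\Psi,k}$ is called a Garsia-type norm on $X$, and $X$ is said to admit a Garsia-type norm. Values $+\infty$ are allowed for $\mathcal N$ and $\|\cdot\|_X$. *)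

(* Defs.v *)
From mathcomp Require Import all_boot all_order all_algebra.
From mathcomp Require Import complex.
From mathcomp Require Import all_classical all_reals all_analysis.

Set Implicit Arguments.
Unset Strict Implicit.
Unset Printing Implicit Defensive.

Import Order.TTheory GRing.Theory Num.Theory.
Import numFieldNormedType.Exports.
Import ComplexField.

Local Open Scope classical_set_scope.
Local Open Scope ring_scope.
Local Open Scope complex_scope.

Section AnalyticFunctions.
Variable K : numFieldType.
Implicit Types (f : K -> K) (a z : K).

Definition analytic_at f a : Prop :=
  exists c : nat -> K,
    \forall z \near a, series (fun k => c k * (z - a) ^+ k) @ \oo --> f z.

Definition zero_order f a (m : nat) : Prop :=
  exists g : K -> K,
    [/\ analytic_at g a, g a != 0
      & \forall z \near a, f z = (z - a) ^+ m * g z].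

(* The order is unique, so [xget] only selects; it is 0 where f does not vanish,
   and also, by default, where f vanishes identically around a. *)
Definition mult f a : nat := xget 0%N [set m | zero_order f a m].

Definition wronskian m (f : 'I_m -> K -> K) z : K :=
  \det (\matrix_(i < m, j < m) derive1n i (f j) z).

(* Stated for K so that the canonical topology of a numFieldType is found;
   used at K := R[i]. *)
Definition limit_at_left (R : realType) (u : R -> K) (x : R) : K :=
  lim (u r @[r --> x^'-]).

End AnalyticFunctions.

Section Disk.
Variable R : realType.
Local Notation C := R[i].
Implicit Types (f : C -> C) (z a : C) (p : R).

Definition cmod z : R := Normc.normc z.

Definition disk : set C := [set z | cmod z < 1].
Definition closed_disk : set C := [set z | cmod z <= 1].

Definition analytic_on (A : set C) f : Prop :=
  forall z, A z -> analytic_at f z.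

Definition constant_on (A : set C) f : Prop :=
  exists w : C, forall z, A z -> f z = w.

(* The finite Blaschke product with multiplicity m a at each a of the disk; the
   default value 1 applies when infinitely many factors differ from 1. *)
Definition blaschke (m : C -> nat) z : C :=
  \big[*%R/1]_(a \in disk) ((z - a) / (1 - a^* * z)) ^+ m a.

Definition blaschke_of f : C -> C := blaschke (mult f).

Definition blaschke_lcm (I : finType) (B : I -> C -> C) : C -> C :=
  blaschke (fun a => \max_(i : I) mult (B i) a)%N.

Definition blaschke_rad (B : C -> C) : C -> C :=
  blaschke (fun a => (0 < mult B a)%N : nat).

Definition circle := {z : C | cmod z == 1}.

Lemma cmod_expi (t : R) : cmod (cos t +i* sin t) == 1.
Proof. by rewrite /cmod /= cos2Dsin2 sqrtr1. Qed.

Definition expi (t : R) : circle := exist _ (cos t +i* sin t) (cmod_expi t).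

Lemma twopi_gt0 : 0 < 2 * pi :> R.
Proof. by rewrite mulr_gt0 ?pi_gt0. Qed.

(* Normalized arclength on the circle, carried by the angle t of expi t:
   a function g on the circle is integrated as g \o expi. *)
Definition arc : probability _ R := uniform_prob twopi_gt0.

(* The class |H^p|. Since lne 0 = -oo, integrability of log g forces g > 0 a.e. *)
Definition modHp p : set (circle -> R) :=
  [set g | [/\ forall zeta, 0 <= g zeta,
     (g \o expi) \in Lfun arc p%:E
   & arc.-integrable setT (fun t => lne (g (expi t))%:E)
     \/ {ae arc, forall t, g (expi t) = 0}]].

Definition hardy p : set (C -> C) :=
  [set f | analytic_on disk f /\
    (ereal_sup [set \int[arc]_t ((cmod (f (r%:C * val (expi t))) `^ p)%:E)
               | r in `[0%R, 1%R[ ] < +oo)%E].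

(* The radial limit, which exists a.e. for f in H^p. *)
Definition boundary_value f (zeta : circle) : C :=
  limit_at_left (fun r : R => f (r%:C * val zeta)) 1.

Definition boundary_modulus f : circle -> R :=
  fun zeta => cmod (boundary_value f zeta).

Definition supnorm f : \bar R :=
  Lnorm arc +oo%E (fun t => (cmod (f (val (expi t))))%:E).

(* A Banach space of analytic functions on the disk, normed modulo constants.
   Functions on the disk are represented by total functions; by
   [space_norm_eq0] a function vanishing on the disk is a member of norm 0, so
   membership and norm depend only on the restriction to the disk. *)
Record analytic_space := AnalyticSpace {
  space_mem : set (C -> C);
  space_norm : (C -> C) -> R;
  space_analytic : forall f, space_mem f -> analytic_on disk f;
  space_add : forall f g, space_mem f -> space_mem g ->
    space_mem (fun z => f z + g z);
  space_scale : forall (a : C) f, space_mem f ->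
    space_mem (fun z => a * f z);
  space_norm_add : forall f g, space_mem f -> space_mem g ->
    space_norm (fun z => f z + g z) <= space_norm f + space_norm g;
  space_norm_scale : forall (a : C) f, space_mem f ->
    space_norm (fun z => a * f z) = cmod a * space_norm f;
  space_norm_eq0 : forall f,
    (space_mem f /\ space_norm f = 0) <-> constant_on disk f;
  space_complete : forall u : nat -> C -> C,
    (forall n, space_mem (u n)) ->
    (forall e : R, 0 < e -> exists N, forall m n, (N <= m)%N -> (N <= n)%N ->
       space_norm (fun z => u m z - u n z) <= e) ->
    exists2 f, space_mem f &
      space_norm (fun z => u n z - f z) @[n --> \oo] --> (0 : R)
}.

Definition space_enorm (X : analytic_space) f : \bar R :=
  if `[< space_mem X f >] then (space_norm X f)%:E else +oo%E.

Section GarsiaNorm.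
Variables (p : R) (Psi : (circle -> R) -> C -> \bar R) (k : C -> R).

(* [Psi] and [k] are only constrained on |H^p| x disk and on the disk. *)
Definition garsia_norm f : \bar R :=
  ereal_sup [set ((Psi (boundary_modulus f) z - (cmod (f z) `^ p)%:E) `^ p^-1
                  * (k z)^-1%:E)%E | z in disk].

Record is_garsia_norm (X : analytic_space) : Prop := IsGarsiaNorm {
  garsia_p_gt0 : 0 < p;
  garsia_sub_hardy : space_mem X `<=` hardy p;
  garsia_Psi_ge0 : forall g z, modHp p g -> disk z -> (0 <= Psi g z)%E;
  (* elements of |H^p| are functions up to a.e. equality *)
  garsia_Psi_ae : forall g h z, modHp p g -> modHp p h -> disk z ->
    {ae arc, forall t, g (expi t) = h (expi t)} -> Psi g z = Psi h z;
  garsia_k_gt0 : forall z, disk z -> 0 < k z;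
  garsia_Psi_homog : forall (l : R) g z, 0 < l -> modHp p g -> disk z ->
    Psi (fun zeta => l * g zeta) z = ((l `^ p)%:E * Psi g z)%E;
  garsia_Psi_ge : forall f z, hardy p f -> disk z ->
    ((cmod (f z) `^ p)%:E <= Psi (boundary_modulus f) z)%E;
  garsia_equiv : exists C1 C2 : R, [/\ 0 < C1, 0 < C2
    & forall f, hardy p f ->
        (garsia_norm f <= C1%:E * space_enorm X f)%E /\
        (space_enorm X f <= C2%:E * garsia_norm f)%E]
}.

End GarsiaNorm.

End Disk.

(* Main.v *)
Require Import Defs.
From mathcomp Require Import all_boot all_order all_algebra.
From mathcomp Require Import complex.
From mathcomp Require Import all_classical all_reals all_analysis.
From mathcomp Require Import ess_sup_inf measurable_realfun ring lra.

Set Implicit Arguments.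
Unset Strict Implicit.
Unset Printing Implicit Defensive.

Import Order.TTheory GRing.Theory Num.Theory.
Import numFieldNormedType.Exports.

Local Open Scope classical_set_scope.
Local Open Scope ring_scope.

(** Let [W] be the Wronskian. By Cramer's rule, if [a] is a zero of order [m] of
    some [f j], then [(z - a) ^ (m - n)] divides [W] at [a]; the last function is
    covered because it is a combination of the others. Hence
    [|BL| >= |J| |BR| ^ n] on the disk, where [J] is the Blaschke product of [W],
    and with Bernoulli's inequality [1 - |BL| ^ p <= (1 - |J| ^ p) + n (1 - |BR| ^ p)].
    Writing [W = F J] with [F] zero-free, [|F| = |W|] on the circle gives
    [|F| ^ p <= Psi |W|], so [|F| ^ p (1 - |J| ^ p) <= Psi |W| - |W| ^ p], and
    [1 / |F| <= sup |1 / W|] by the minimum principle. Subadditivity of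
    [t ^ (1 / p)] concludes, with the constant 1 where the theorem has [mu >= 1].

    Analyticity is handled by power series with explicit remainder bounds;
    connectedness of the disk is replaced by extremal arguments: a closed set
    containing a neighborhood of each of its points in the open disk meets the circle. *)

(** * Neighborhoods and limits in the complex plane *)

(** A finite Blaschke product [B] has modulus 1 on the circle, so the normalization of [Psi] at the
    constant 1 makes its Garsia norm the supremum of [(1 - |B z| ^ p) ^ (1 / p) / k z]. The first
    inequality is therefore proved at each [z] separately, as a statement about three numbers of
    [[0, 1]], the moduli of [BL], [J] and [BR] at [z]. The loss of [n] in the orders comes from the
    [n] derivatives in the last row of the Wronskian. It is charged only at the zeros of some [f j],
    which is what the [n]-th power of the radical records. Passing from [W] to the zero-free [F] is
    forced by the interior zeros of [W]: there [1 / W] has poles, whereas [1 / F] is controlled by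
    its values on the circle. That [mu >= 1] is seen by evaluating [W] and [1 / W] at one point of
    the circle. The second inequality follows from the first through the two comparison constants
    between the norms, so [c] depends neither on [n] nor on the functions. *)

Section NumFieldTopology.
Variable K : numFieldType.
Implicit Types (a l z : K).

Lemma nearE_norm (P : K -> Prop) a :
  (\forall z \near a, P z) <->
  exists2 e : K, 0 < e & forall z, `|z - a| < e -> P z.
Proof.
split=> [/nbhs_normP[e /= e0 h]|[e e0 h]].
  by exists e => // z ze; apply: h; rewrite /ball_/= distrC.
by apply/nbhs_normP; exists e => // z /=; rewrite distrC; exact: h.
Qed.

Lemma cvg_seqE_norm (u : nat -> K) l :
  (u @ \oo --> l) <->
  forall e : K, 0 < e -> exists N, forall n, (N <= n)%N -> `|u n - l| < e.
Proof.
split=> [/cvgrPdist_lt h e /h [N _ hN]|h].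
  by exists N => n Nn; rewrite distrC; exact: hN.
apply/cvgrPdist_lt => e /h[N hN]; exists N => // n /= Nn.
by rewrite distrC; exact: hN.
Qed.

Lemma is_derive_eps (f : K -> K) a l :
  (forall e : K, 0 < e -> exists2 d : K, 0 < d &
     forall h, h != 0 -> `|h| < d -> `|h^-1 * (f (h + a) - f a) - l| < e) ->
  is_derive a 1 f l.
Proof.
move=> H; have cv : h^-1 *: (f (h *: 1 + a) - f a) @[h --> 0^'] --> l.
  apply/cvgrPdist_lt => e /H[d d0 hd].
  rewrite near_withinE; apply/nearE_norm; exists d => // h; rewrite subr0 => hh h0.
  by rewrite distrC /GRing.scale /= mulr1; exact: hd.
apply: DeriveDef; first by apply/cvg_ex; exists l.
exact: cvg_lim cv.
Qed.

Lemma derive1_mulX (f : K -> K) a z l : is_derive z 1 f l ->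
  derive1 (fun x => (x - a) * f x) z = f z + (z - a) * l.
Proof.
move=> fz; rewrite derive1E.
have xz : is_derive z 1 (fun x : K => x - a) 1 by apply: is_derive_eq; rewrite subr0.
have [_ dv] := is_deriveM xz fz; apply: (etrans dv).
by rewrite /GRing.scale /= mulr1 addrC.
Qed.

Lemma derive1_lincomb n (u : 'I_n -> K) (f : 'I_n -> K -> K) (l : 'I_n -> K) z :
  (forall i, is_derive z 1 (f i) (l i)) ->
  derive1 (fun x => \sum_i u i * f i x) z = \sum_i u i * l i.
Proof.
move=> fl; rewrite derive1E.
have [_ dv] : is_derive z 1 (\sum_i (u i \*: f i)) (\sum_i u i *: l i).
  by apply: is_derive_sum => i; exact: is_deriveZ.
by rewrite -[RHS]dv; congr ('D_1 _ z); apply/funext => x; rewrite fct_sumE.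
Qed.

Lemma near_derive1 (f g : K -> K) a :
  (\forall z \near a, f z = g z) -> derive1 f a = derive1 g a.
Proof.
move=> /[dup] fg /nearE_norm[e e0 h]; rewrite /derive1.
have faga : f a = g a by apply: h; rewrite subrr normr0.
congr lim; rewrite eqEsubset; split; apply/near_eq_cvg; rewrite near_withinE;
  by apply/nearE_norm; exists e => // x; rewrite subr0 => xe _; rewrite faga h // addrK.
Qed.

Lemma limit_at_left_eq (R : realType) (u : R -> K) x l :
  (forall e : K, 0 < e -> exists2 d : R, 0 < d &
     forall y, y < x -> x - y < d -> `|u y - l| < e) ->
  limit_at_left u x = l.
Proof.
move=> H; rewrite /limit_at_left; apply/cvg_lim => //.
apply/cvgrPdist_lt => e /H[d d0 hd].
rewrite near_withinE; apply/nbhs_normP; exists d => // y /= yd yx.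
by rewrite distrC; apply: hd => //; move: yd; rewrite ger0_norm // subr_ge0 ltW.
Qed.

Lemma near_forall (I : finType) (P : I -> K -> Prop) a :
  (forall i, \forall z \near a, P i z) -> \forall z \near a, forall i, P i z.
Proof. by move=> h; apply: (@filter_forall K I P (nbhs a) _ h). Qed.

End NumFieldTopology.

(** * The real-valued modulus and the topology it induces *)

Section ComplexModulus.
Variable R : realType.
Local Notation C := R[i].
Implicit Types (f : C -> C) (z w a l : C).

Lemma norm_cmod z : `|z| = (cmod z)%:C%C.
Proof. by case: z => x y; rewrite normc_def. Qed.

Lemma gt0_complex (e : C) : 0 < e -> exists2 d : R, 0 < d & e = d%:C%C.
Proof.
case: e => x y; rewrite ltcE /= => /andP[/eqP y0 x0].
by exists x => //; rewrite y0.
Qed.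

Lemma ltc_normE z (e : R) : (`|z| < e%:C%C) = (cmod z < e).
Proof. by rewrite norm_cmod ltcR. Qed.

Lemma cmod_ge0 z : 0 <= cmod z.
Proof. by case: z => x y; exact: sqrtr_ge0. Qed.

Lemma cmodM z w : cmod (z * w) = cmod z * cmod w.
Proof. exact: Normc.normcM. Qed.

Lemma cmodD z w : cmod (z + w) <= cmod z + cmod w.
Proof. exact: le_normcD. Qed.

Lemma cmodN z : cmod (- z) = cmod z.
Proof. exact: normcN. Qed.

Lemma cmodB z w : cmod (z - w) <= cmod z + cmod w.
Proof. by rewrite -(cmodN w) cmodD. Qed.

Lemma cmodC z w : cmod (z - w) = cmod (w - z).
Proof. by rewrite -cmodN opprB. Qed.

Lemma cmod0 : cmod (0 : C) = 0.
Proof. exact: Normc.normc0. Qed.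

Lemma cmod1 : cmod (1 : C) = 1.
Proof. exact: Normc.normc1. Qed.

Lemma cmodV z : cmod z^-1 = (cmod z)^-1.
Proof. exact: Normc.normcV. Qed.

Lemma cmodX z n : cmod (z ^+ n) = cmod z ^+ n.
Proof. by elim: n => [|n IH]; rewrite ?expr0 ?cmod1 // !exprS cmodM IH. Qed.

Lemma cmod_eq0 z : (cmod z == 0) = (z == 0).
Proof.
by apply/eqP/eqP => [/Normc.eq0_normc|->] //; rewrite cmod0.
Qed.

Lemma cmod_gt0 z : (0 < cmod z) = (z != 0).
Proof. by rewrite lt_neqAle cmod_ge0 andbT eq_sym cmod_eq0. Qed.

Lemma cmod_real (x : R) : cmod x%:C%C = `|x|.
Proof. by rewrite /cmod /= expr0n /= addr0 sqrtr_sqr. Qed.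

Lemma cmod_conj z : cmod (z^*)%C = cmod z.
Proof. by case: z => x y; rewrite /cmod /= sqrrN. Qed.

Lemma cmod_nat n : cmod (n%:R : C) = n%:R.
Proof. by rewrite -[n%:R]/(n%:R) -(rmorph_nat (real_complex R)) cmod_real normr_nat. Qed.

Lemma cmod_prod (I : Type) (s : seq I) (P : pred I) (F : I -> C) :
  cmod (\prod_(i <- s | P i) F i) = \prod_(i <- s | P i) cmod (F i).
Proof. by apply: (big_morph _ cmodM cmod1). Qed.

Lemma cmod_sum (I : Type) (s : seq I) (P : pred I) (F : I -> C) :
  cmod (\sum_(i <- s | P i) F i) <= \sum_(i <- s | P i) cmod (F i).
Proof.
elim/big_rec2: _ => [|i x y _ h]; first by rewrite cmod0.
by apply: (le_trans (cmodD _ _)); rewrite lerD2l.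
Qed.

Lemma cmod_Re z : `|complex.Re z| <= cmod z.
Proof. by have := normc_ge_Re z; rewrite norm_cmod lecR. Qed.

Lemma cmod_Im z : `|complex.Im z| <= cmod z.
Proof. by case: z => x y; rewrite /cmod /= -sqrtr_sqr ler_wsqrtr // lerDr sqr_ge0. Qed.

Lemma cmod_le_ReIm z : cmod z <= `|complex.Re z| + `|complex.Im z|.
Proof.
have {1}-> : z = ((complex.Re z)%:C + (0 +i* complex.Im z))%C :> C.
  by case: z => x y; apply/eqP; rewrite eq_complex /= addr0 add0r !eqxx.
apply: (le_trans (cmodD _ _)); rewrite cmod_real lerD2l.
by rewrite /cmod /= expr0n add0r sqrtr_sqr.
Qed.

(** Radii in the topology of [C] as a numeric field are positive elements of [C], that is, embedded
    positive reals. This lemma and the next two trade them for elements of [R]. *)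
Lemma near_cmodP (P : C -> Prop) a :
  (\forall z \near (a : (C : numFieldType)), P z) <->
  exists2 e : R, 0 < e & forall z, cmod (z - a) < e -> P z.
Proof.
rewrite nearE_norm; split=> [[e /gt0_complex[d d0 ->] h]|[e e0 h]].
  by exists d => // z; rewrite -ltc_normE; exact: h.
by exists e%:C%C; rewrite ?ltcR // => z; rewrite ltc_normE; exact: h.
Qed.

Lemma cvg_cmodP (u : nat -> C) l :
  ((u : nat -> (C : numFieldType)) @ \oo --> (l : (C : numFieldType))) <->
  (fun n => cmod (u n - l)) @ \oo --> (0 : R).
Proof.
rewrite cvg_seqE_norm; split=> h.
  apply/cvgrPdist_lt => e e0; have [|N hN] := h e%:C%C; first by rewrite ltcR.
  exists N => // n /= /hN; rewrite ltc_normE sub0r normrN ger0_norm //.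
  exact: cmod_ge0.
move=> e /gt0_complex[d d0 ->]; move/cvgrPdist_lt : h => /(_ _ d0)[N _ hN].
exists N => n Nn; rewrite ltc_normE; have := hN n Nn.
by rewrite /= sub0r normrN ger0_norm // cmod_ge0.
Qed.

Lemma is_derive_cmod f a l :
  (forall e : R, 0 < e -> exists2 d : R, 0 < d &
     forall h, h != 0 -> cmod h < d -> cmod ((f (h + a) - f a) / h - l) < e) ->
  is_derive (a : (C : numFieldType)) 1 (f : (C : numFieldType) -> (C : numFieldType)) l.
Proof.
move=> H; apply: is_derive_eps => e /gt0_complex[d /H[x x0 hx] ->].
exists x%:C%C; first by rewrite ltcR.
by move=> h h0; rewrite !ltc_normE mulrC; exact: hx.
Qed.

Definition continuousC_at f a := forall e : R, 0 < e ->
  exists2 d : R, 0 < d & forall z, cmod (z - a) < d -> cmod (f z - f a) < e.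

(** The point [y * zeta] of the radius lies at distance [1 - y] from [zeta], so continuity at [zeta]
    alone determines the radial limit. *)
Lemma boundary_value_continuous f (zeta : circle R) :
  continuousC_at f (val zeta) -> boundary_value f zeta = f (val zeta).
Proof.
move=> fc; rewrite /boundary_value; apply: limit_at_left_eq => e /gt0_complex[d].
move=> /fc[x x0 hx] ->; exists x => // y y1 yx.
rewrite ltc_normE; apply: hx; rewrite -{2}[val zeta]mul1r -mulrBl cmodM.
have -> : (y%:C - 1 = (y - 1)%:C :> C)%C by rewrite rmorphB.
rewrite cmod_real (eqP (valP zeta)) mulr1 ltr0_norm ?subr_lt0 //.
by rewrite opprB.
Qed.

End ComplexModulus.

(** * Power series *)

Section Series.
Variable R : realType.
Local Notation C := R[i].
Implicit Types (f g : C -> C) (z w a l : C) (u c d : nat -> C).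

(** Lets a factor linear in [n] be absorbed by halving a radius. *)
Lemma succ_le_exp2 n : n.+1%:R <= 2 ^+ n :> R.
Proof. by rewrite -natrX ler_nat ltn_expl. Qed.

Lemma cmod_limit_le u l z B n : (fun n => cmod (u n - l)) @ \oo --> (0 : R) ->
  (forall m, (n <= m)%N -> cmod (u m - z) <= B) -> cmod (l - z) <= B.
Proof.
move=> ul uz; apply/ler_addgt0Pl => e e0; move/cvgrPdist_lt: ul => /(_ _ e0)[N _ h].
have := h (maxn N n) (leq_maxl _ _); have := uz (maxn N n) (leq_maxr _ _).
rewrite /= sub0r normrN ger0_norm ?cmod_ge0 // => h1 h2.
have -> : l - z = (u (maxn N n) - z) - (u (maxn N n) - l) by ring.
by apply: (le_trans (cmodB _ _)); lra.
Qed.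

(** The factor 2 bounds [1 / (1 - q)] for [q <= 1/2]. The induction runs on the stronger bound with
    [2 * A * q ^+ (n + j)] subtracted, whose decrease at each step pays for the new term. *)
Lemma geometric_tail d A q : 0 <= q <= 2^-1 ->
  (forall k, cmod (d k) <= A * q ^+ k) ->
  forall n m, (n <= m)%N ->
  cmod (\sum_(k < m) d k - \sum_(k < n) d k) <= 2 * A * q ^+ n.
Proof.
move=> /andP[q0 q1] dA n m nm.
have A0 : 0 <= A by have := dA 0%N; rewrite expr0 mulr1; apply: le_trans; exact: cmod_ge0.
suff h j : cmod (\sum_(k < n + j) d k - \sum_(k < n) d k) <=
    2 * A * q ^+ n - 2 * A * q ^+ (n + j).
  have := h (m - n)%N; rewrite subnKC // => /le_trans; apply.
  by rewrite gerBl !mulr_ge0 ?exprn_ge0 //.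
elim: j => [|j IH]; first by rewrite addn0 !subrr cmod0.
rewrite addnS big_ord_recr /= addrAC; apply: (le_trans (cmodD _ _)).
apply: (le_trans (lerD IH (dA _))).
have : 0 <= A * q ^+ (n + j) by rewrite mulr_ge0 // exprn_ge0.
rewrite exprS; set x := q ^+ (n + j); set y := q ^+ n => Ax.
rewrite -subr_ge0.
have -> : 2 * A * y - 2 * A * (q * x) - (2 * A * y - 2 * A * x + A * x)
  = 2 * ((A * x) * (2^-1 - q)) by field.
by rewrite mulr_ge0 ?(mulr_ge0 Ax) ?subr_ge0 //.
Qed.

(** Real and imaginary parts are dominated by the same geometric series and converge separately; the
    bound on the tails then passes to the limit. *)
Lemma geometric_limit d A q : 0 <= q <= 2^-1 ->
  (forall k, cmod (d k) <= A * q ^+ k) ->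
  exists l, forall n, cmod (l - \sum_(k < n) d k) <= 2 * A * q ^+ n.
Proof.
move=> q01 dA; have tl := geometric_tail q01 dA.
have /andP[q0 q1] := q01.
have A0 : 0 <= A by have := dA 0%N; rewrite expr0 mulr1; apply: le_trans; exact: cmod_ge0.
have cv (v : nat -> R) : (forall k, `|v k| <= cmod (d k)) -> cvgn (series v).
  move=> vd; apply: normed_cvg.
  apply: (@series_le_cvg _ _ (geometric A q)).
  - by move=> n /=; exact: normr_ge0.
  - by move=> n; apply: mulr_ge0 => //; exact: exprn_ge0.
  - by move=> n; exact: le_trans (vd n) (dA n).
  - by apply: is_cvg_geometric_series; rewrite ger0_norm //; lra.
have /cvg_ex[x hx] := cv _ (fun k => cmod_Re (d k)).
have /cvg_ex[y hy] := cv _ (fun k => cmod_Im (d k)).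
exists (x +i* y)%C => n; apply: (@cmod_limit_le (fun n => \sum_(k < n) d k) _ _ _ n).
  2: by move=> m nm; exact: tl.
have ReS m : complex.Re (\sum_(k < m) d k) = series (fun k => complex.Re (d k)) m.
  rewrite seriesEord /=; elim: m => [|m IH]; first by rewrite !big_ord0.
  by rewrite !big_ord_recr /= -IH; case: (\sum_(_ < _) _) => ? ?; case: (d m).
have ImS m : complex.Im (\sum_(k < m) d k) = series (fun k => complex.Im (d k)) m.
  rewrite seriesEord /=; elim: m => [|m IH]; first by rewrite !big_ord0.
  by rewrite !big_ord_recr /= -IH; case: (\sum_(_ < _) _) => ? ?; case: (d m).
have h0 : (fun m => `|series (fun k => complex.Re (d k)) m - x| +
    `|series (fun k => complex.Im (d k)) m - y|) @ \oo --> (0 : R).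
  rewrite -(addr0 0); apply: cvgD.
    by rewrite -(normr0 R); apply: cvg_norm; rewrite -(subrr x); apply: cvgB hx _; exact: cvg_cst.
  by rewrite -(normr0 R); apply: cvg_norm; rewrite -(subrr y); apply: cvgB hy _; exact: cvg_cst.
apply: (squeeze_cvgr _ (cvg_cst 0) h0); near=> m.
rewrite cmod_ge0 /= (le_trans (cmod_le_ReIm _)) // -ReS -ImS.
by case: (\sum_(_ < _) _).
Unshelve. all: by end_near. Qed.

(* The remainder of order n is [O(w ^+ n)] uniformly in n: this encodes the
   convergence of the series on [cmod w < r], together with Cauchy's bounds on
   its coefficients. *)
Definition power_expansion f a c (r M : R) : Prop :=
  0 < r /\ forall n w, cmod w <= r ->
    cmod (f (a + w) - \sum_(k < n) c k * w ^+ k) * r ^+ n <= M * cmod w ^+ n.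

Definition expandable f a := exists c r M, power_expansion f a c r M.

Lemma expansion_ge0 f a c r M : power_expansion f a c r M -> 0 <= M.
Proof.
move=> [r0 /(_ 0%N 0)]; rewrite cmod0 !expr0 !mulr1 => h.
by apply: le_trans (h (ltW r0)); exact: cmod_ge0.
Qed.

(** At [w = r] the [k]-th term is the difference of the remainders of orders [k] and [k + 1], each
    of modulus at most [M]. *)
Lemma expansion_coef f a c r M : power_expansion f a c r M ->
  forall k, cmod (c k) * r ^+ k <= 2 * M.
Proof.
move=> [r0 h] k; have cr : cmod (r%:C)%C = r by rewrite cmod_real gtr0_norm.
have rk : 0 < r ^+ k by rewrite exprn_gt0.
have := h k (r%:C)%C; have := h k.+1 (r%:C)%C; rewrite cr lexx => /(_ isT) h1 /(_ isT) h2.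
have h1' : cmod (f (a + (r%:C)%C) - \sum_(i < k.+1) c i * (r%:C)%C ^+ i) <= M.
  by rewrite -(ler_pM2r (exprn_gt0 k.+1 r0)).
have h2' : cmod (f (a + (r%:C)%C) - \sum_(i < k) c i * (r%:C)%C ^+ i) <= M.
  by rewrite -(ler_pM2r rk).
move: h1' h2'; rewrite big_ord_recr /=; set F := f _; set S := \sum_(_ < _) _ => h1' h2'.
have -> : cmod (c k) * r ^+ k = cmod (c k * (r%:C)%C ^+ k) by rewrite cmodM cmodX cr.
have -> : c k * (r%:C)%C ^+ k = (F - S) - (F - (S + c k * (r%:C)%C ^+ k)) by ring.
by apply: (le_trans (cmodB _ _)); lra.
Qed.

Lemma expansion_shrink f a c r M r' : power_expansion f a c r M ->
  0 < r' <= r -> power_expansion f a c r' M.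
Proof.
move=> [r0 h] /andP[r'0 r'r]; split => // n w wr'.
apply: le_trans (h n w (le_trans wr' r'r)).
by rewrite ler_wpM2l ?cmod_ge0 // lerXn2r // nnegrE ltW.
Qed.

Lemma expansion_center f a c r M : power_expansion f a c r M -> f a = c 0%N.
Proof.
move=> [r0 /(_ 1%N 0)]; rewrite cmod0 => /(_ (ltW r0)).
rewrite big_ord1 addr0 !expr0 !expr1 mulr1 mulr0 => h; apply/eqP.
rewrite -subr_eq0 -cmod_eq0 eq_le cmod_ge0 andbT.
by rewrite -(ler_pM2r r0) mul0r.
Qed.

(** On half the radius the ratio [cmod w / rho] is at most [1/2], as [geometric_limit] demands. The
    sum is chosen point by point; its values farther away are arbitrary. *)
Lemma expansion_of_coef c (rho A : R) a : 0 < rho ->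
  (forall k, cmod (c k) * rho ^+ k <= A) ->
  exists g, power_expansion g a c (rho / 2) (2 * A).
Proof.
move=> rho0 cA.
have ex w : exists l, cmod w <= rho / 2 ->
    forall n, cmod (l - \sum_(k < n) c k * w ^+ k) <= 2 * A * (cmod w / rho) ^+ n.
  have [wr|wr] := boolP (cmod w <= rho / 2); last by exists 0.
  have [] := @geometric_limit (fun k => c k * w ^+ k) A (cmod w / rho).
  - by rewrite divr_ge0 ?cmod_ge0 ?(ltW rho0) //= ler_pdivrMr // mulrC.
  - move=> k; rewrite cmodM cmodX expr_div_n mulrA mulrAC.
    by rewrite ler_wpM2r ?exprn_ge0 ?cmod_ge0 // ler_pdivlMr ?exprn_gt0.
  by move=> l hl; exists l.
have [G HG] := choice ex.
exists (fun z => G (z - a)); split; first by rewrite divr_gt0.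
move=> n w wr; rewrite addrAC subrr add0r.
apply: (le_trans (ler_wpM2r _ (HG w wr n))).
  by rewrite exprn_ge0 // divr_ge0 // ltW.
have A0 : 0 <= A by have := cA 0%N; rewrite expr0 mulr1; apply: le_trans; exact: cmod_ge0.
rewrite -(mulrA (2 * A)) -exprMn; apply: ler_wpM2l; first by rewrite mulr_ge0.
have -> : cmod w / rho * (rho / 2) = cmod w / 2 by field; exact: lt0r_neq0.
by rewrite lerXn2r ?nnegrE ?divr_ge0 ?cmod_ge0 // ler_pdivrMr // ler_peMr ?cmod_ge0 // ler1n.
Qed.

Lemma expansion_half f a c r M n w : power_expansion f a c r M ->
  cmod w <= r / 2 -> cmod (f (a + w) - \sum_(k < n) c k * w ^+ k) <= M * 2^-1 ^+ n.
Proof.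
move=> H wr; have M0 := expansion_ge0 H; case: H => r0 h.
rewrite -(ler_pM2r (exprn_gt0 n r0)).
have wr' : cmod w <= r by apply: (le_trans wr); rewrite ler_pdivrMr //; lra.
apply: (le_trans (h n w wr')); rewrite -mulrA ler_wpM2l // -exprMn.
by rewrite lerXn2r ?nnegrE ?cmod_ge0 ?mulr_ge0 ?(ltW r0) // mulrC.
Qed.

Lemma cvg_half (M : R) : (fun n => M * 2^-1 ^+ n) @ \oo --> (0 : R).
Proof. by apply: cvg_geometric; rewrite ger0_norm //; lra. Qed.

Lemma expansion_cvg f a c r M w : power_expansion f a c r M -> cmod w <= r / 2 ->
  (fun n => cmod (\sum_(k < n) c k * w ^+ k - f (a + w))) @ \oo --> (0 : R).
Proof.
move=> H wr; apply: (squeeze_cvgr _ (cvg_cst 0) (cvg_half M)).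
by apply: nearW => n; rewrite cmod_ge0 /= cmodC; exact: expansion_half H wr.
Qed.

Lemma cmod_limit_unique u l z : (fun n => cmod (u n - l)) @ \oo --> (0 : R) ->
  (fun n => cmod (u n - z)) @ \oo --> (0 : R) -> l = z.
Proof.
move=> ul uz; apply/eqP; rewrite -subr_eq0 -cmod_eq0 eq_le cmod_ge0 andbT.
apply/ler_addgt0Pl => e e0; rewrite addr0.
move/cvgrPdist_lt: uz => /(_ _ e0)[N _ h].
apply: (@cmod_limit_le u l z e N) => // m Nm; have := h m Nm.
by rewrite /= sub0r normrN ger0_norm ?cmod_ge0 // => /ltW.
Qed.

(** Convergence at one point of modulus [r0] bounds the terms there, hence the coefficients; these
    define a sum [g] with explicit remainders, and [g] agrees with [f] by uniqueness of limits. *)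
Lemma analytic_atP f a :
  analytic_at (f : (C : numFieldType) -> (C : numFieldType)) a <-> expandable f a.
Proof.
split.
  move=> [c /near_cmodP[e e0 h]].
  set r0 := e / 2; have r00 : 0 < r0 by rewrite divr_gt0.
  have cv w : cmod w < e ->
      (fun n => cmod (\sum_(k < n) c k * w ^+ k - f (a + w))) @ \oo --> (0 : R).
    move=> we; have /h : cmod (a + w - a) < e by rewrite addrAC subrr add0r.
    move/cvg_cmodP; rewrite addrAC subrr add0r.
    by under eq_fun do rewrite seriesEord.
  have [A hA] : exists A, forall k, cmod (c k) * r0 ^+ k <= A.
    have cr : cmod (r0%:C)%C = r0 by rewrite cmod_real gtr0_norm.
    have /cv cvr : cmod (r0%:C)%C < e by rewrite cr /r0; lra.
    have [B [_ hB]] := cvg_seq_bounded (cvgP _ cvr).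
    have {}hB n : cmod (\sum_(k < n) c k * (r0%:C)%C ^+ k - f (a + (r0%:C)%C)) <= B + 1.
      have /hB /(_ n I) : B < B + 1 by rewrite ltrDl.
      by rewrite /= ger0_norm // cmod_ge0.
    exists (2 * (B + 1)) => k.
    have -> : cmod (c k) * r0 ^+ k = cmod (c k * (r0%:C)%C ^+ k) by rewrite cmodM cmodX cr.
    have := hB k; have := hB k.+1; rewrite big_ord_recr /=; set S := \sum_(_ < _) _; set F := f _.
    move=> h1 h2.
    have -> : c k * (r0%:C)%C ^+ k = (S + c k * (r0%:C)%C ^+ k - F) - (S - F) by ring.
    by apply: (le_trans (cmodB _ _)); lra.
  have [g [r'0 hg]] := expansion_of_coef a r00 hA.
  (* One halving comes from [expansion_of_coef], the other from [expansion_cvg], which gives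
     convergence only on half the radius of an expansion. *)
  have r4 : 0 < r0 / 2 / 2 <= r0 / 2 by apply/andP; split; rewrite /r0; lra.
  exists c, (r0 / 2 / 2), (2 * A).
  have hg' := expansion_shrink (conj r'0 hg) r4; split; first by case: hg'.
  move=> n w wr; suff -> : f (a + w) = g (a + w) by case: hg' => _; exact.
  have we : cmod w < e by rewrite (le_lt_trans wr) // /r0; lra.
  exact: cmod_limit_unique (cv w we) (expansion_cvg (conj r'0 hg) wr).
move=> [c [r [M H]]]; exists c; have r0 : 0 < r by case: H.
apply/near_cmodP; exists (r / 2); first by rewrite divr_gt0.
move=> z zr; apply/cvg_cmodP; have := expansion_cvg H (ltW zr).
rewrite (addrC a) subrK; apply: cvg_trans; apply: near_eq_cvg; apply: nearW => n.
by rewrite seriesEord.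
Qed.
End Series.

(** * Algebraic closure properties of functions with a power series expansion *)

Section Expandable.
Variable R : realType.
Local Notation C := R[i].
Implicit Types (f g : C -> C) (z w a l : C) (u c d : nat -> C).

Definition near_at a (P : C -> Prop) := \forall z \near (a : (C : numFieldType)), P z.

Lemma expandable_near f g a : near_at a (fun z => f z = g z) ->
  expandable f a -> expandable g a.
Proof.
move=> /near_cmodP[e e0 fg] [c [r [M H]]]; have r0 : 0 < r by case: H.
have rr : 0 < Num.min r (e / 2) <= r.
  by rewrite lt_min r0 divr_gt0 //= ge_min lexx.
exists c, (Num.min r (e / 2)), M; have [h0 h] := expansion_shrink H rr.
split=> // n w wr; rewrite -fg; first exact: h.
rewrite addrAC subrr add0r (le_lt_trans wr) // gt_min; apply/orP; right.
by rewrite ltr_pdivrMr //; lra.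
Qed.

Lemma expandable_cst b a : expandable (fun=> b) a.
Proof.
exists (fun k => if k is 0%N then b else 0), 1, (cmod b); split => // n w w1.
case: n => [|n]; first by rewrite big_ord0 subr0 !expr0.
rewrite big_ord_recl big1 => [|i _]; last by rewrite /= mul0r.
by rewrite expr0 mulr1 addr0 subrr cmod0 mul0r mulr_ge0 ?exprn_ge0 ?cmod_ge0.
Qed.

Lemma expandable_id a : expandable id a.
Proof.
exists (fun k => match k with 0%N => a | 1%N => 1 | _ => 0 end), 1, (cmod a + 1).
split => // n w w1; have a0 := cmod_ge0 a; have w0 := cmod_ge0 w.
case: n => [|[|n]].
- by rewrite big_ord0 subr0 !expr0 !mulr1; apply: (le_trans (cmodD _ _)); lra.
- by rewrite big_ord1 expr0 mulr1 addrAC subrr add0r !expr1 mulr1; nra.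
rewrite !big_ord_recl big1 => [|i _]; last by rewrite /= mul0r.
rewrite expr0 mulr1 /= expr1 mul1r addr0 subrr cmod0 mul0r.
by rewrite mulr_ge0 ?exprn_ge0 //; lra.
Qed.

Lemma expandable_common f g a : expandable f a -> expandable g a ->
  exists c d r M1 M2, power_expansion f a c r M1 /\ power_expansion g a d r M2.
Proof.
move=> [c [r1 [M1 H1]]] [d [r2 [M2 H2]]].
have r10 : 0 < r1 by case: H1.
have r20 : 0 < r2 by case: H2.
exists c, d, (Num.min r1 r2), M1, M2.
by split; [apply: (expansion_shrink H1)|apply: (expansion_shrink H2)];
  rewrite lt_min r10 r20 /= ge_min lexx ?orbT.
Qed.

Lemma expandableD f g a : expandable f a -> expandable g a ->
  expandable (fun z => f z + g z) a.
Proof.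
move=> fa ga; have [c [d [r [M1 [M2 [[r0 H1] [_ H2]]]]]]] := expandable_common fa ga.
exists (fun k => c k + d k), r, (M1 + M2); split => // n w wr.
have -> : \sum_(k < n) (c k + d k) * w ^+ k =
    \sum_(k < n) c k * w ^+ k + \sum_(k < n) d k * w ^+ k.
  by rewrite -big_split; apply: eq_bigr => i _; rewrite mulrDl.
rewrite opprD addrACA mulrDl; apply: le_trans (lerD (H1 n w wr) (H2 n w wr)).
by rewrite -mulrDl ler_wpM2r ?cmodD // exprn_ge0 // ltW.
Qed.

(** Grouping the truncated product by the index of [c] leaves partial sums of [d] of length [n - i],
    so that the remainders of the second factor appear in the product. *)
Lemma cauchy_product c d w n :
  \sum_(k < n) (\sum_(i < k.+1) c i * d (k - i)%N) * w ^+ k =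
  \sum_(i < n) c i * w ^+ i * \sum_(j < n - i) d j * w ^+ j.
Proof.
elim: n => [|n IH]; first by rewrite !big_ord0.
rewrite big_ord_recr /= IH [RHS]big_ord_recr /= subSn // subnn big_ord1 expr0 mulr1.
rewrite big_ord_recr /= subnn mulrDl addrA; congr (_ + _); last by ring.
rewrite mulr_suml -big_split /=; apply: eq_bigr => i _.
have ni : (i <= n)%N by rewrite ltnW.
rewrite subSn // big_ord_recr /= mulrDr; congr (_ + _).
have -> : w ^+ n = w ^+ i * w ^+ (n - i) by rewrite -exprD subnKC.
by ring.
Qed.

(** The remainder of the product splits into the remainder of [f] times [g], plus [n] terms
    [c i * w ^+ i] times a remainder of [g] of order [n - i]. Up to the factor [(cmod w / r) ^+ n],
    the first is at most [M1 * M2] and each of the others at most [2 * (M1 * M2)]. Halving the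
    radius absorbs the resulting [2 * n + 1]. *)
Lemma expandableM f g a : expandable f a -> expandable g a ->
  expandable (fun z => f z * g z) a.
Proof.
move=> fa ga; have [c [d [r [M1 [M2 [P1 P2]]]]]] := expandable_common fa ga.
have M10 := expansion_ge0 P1; have M20 := expansion_ge0 P2.
have cM := expansion_coef P1; have [r0 H1] := P1; have [_ H2] := P2.
exists (fun k => \sum_(i < k.+1) c i * d (k - i)%N), (r / 2), (2 * (M1 * M2)).
split; first by rewrite divr_gt0.
move=> n w wr'; have wr : cmod w <= r by lra.
rewrite cauchy_product; set F := f (a + w); set G := g (a + w).
have -> : F * G - \sum_(i < n) c i * w ^+ i * \sum_(j < n - i) d j * w ^+ j =
   (F - \sum_(k < n) c k * w ^+ k) * G +
   \sum_(i < n) c i * w ^+ i * (G - \sum_(j < n - i) d j * w ^+ j).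
  under [X in _ = _ + X]eq_bigr do rewrite mulrBr.
  by rewrite sumrB -mulr_suml; ring.
suff h : cmod ((F - \sum_(k < n) c k * w ^+ k) * G +
   \sum_(i < n) c i * w ^+ i * (G - \sum_(j < n - i) d j * w ^+ j)) * r ^+ n <=
   (2 * n%:R + 1) * (M1 * M2) * cmod w ^+ n.
  rewrite expr_div_n [leLHS]mulrA ler_pdivrMr ?exprn_gt0 //; apply: (le_trans h).
  have -> : 2 * (M1 * M2) * cmod w ^+ n * 2 ^+ n =
    2 * 2 ^+ n * (M1 * M2) * cmod w ^+ n by ring.
  rewrite !ler_wpM2r ?exprn_ge0 ?cmod_ge0 ?mulr_ge0 //.
  by have := succ_le_exp2 R n; rewrite -natr1; lra.
apply: (le_trans (ler_wpM2r (exprn_ge0 _ (ltW r0)) (cmodD _ _))).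
rewrite [leLHS]mulrDl.
have -> : (2 * n%:R + 1) * (M1 * M2) * cmod w ^+ n =
  M1 * cmod w ^+ n * M2 + 2 * n%:R * (M1 * M2) * cmod w ^+ n by ring.
apply: lerD.
  rewrite cmodM mulrAC; apply: ler_pM => //.
  - by rewrite mulr_ge0 ?cmod_ge0 ?exprn_ge0 ?ltW.
  - exact: cmod_ge0.
  - exact: H1.
  - by have := H2 0%N w wr; rewrite big_ord0 subr0 !expr0 !mulr1.
apply: (le_trans (ler_wpM2r (exprn_ge0 _ (ltW r0)) (cmod_sum _ _ _))).
have -> : 2 * n%:R * (M1 * M2) * cmod w ^+ n =
   \sum_(i < n) (2 * (M1 * M2) * cmod w ^+ n).
  by rewrite sumr_const card_ord -mulr_natl; ring.
rewrite mulr_suml; apply: ler_sum => i _.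
have ni : (i <= n)%N by rewrite ltnW.
have -> : cmod (c i * w ^+ i * (G - \sum_(j < n - i) d j * w ^+ j)) * r ^+ n =
  (cmod (c i) * r ^+ i) * cmod w ^+ i *
  (cmod (G - \sum_(j < n - i) d j * w ^+ j) * r ^+ (n - i)).
  have -> : r ^+ n = r ^+ i * r ^+ (n - i) by rewrite -exprD subnKC.
  by rewrite !cmodM cmodX; ring.
have -> : 2 * (M1 * M2) * cmod w ^+ n =
   (2 * M1 * cmod w ^+ i) * (M2 * cmod w ^+ (n - i)).
  have -> : cmod w ^+ n = cmod w ^+ i * cmod w ^+ (n - i) by rewrite -exprD subnKC.
  by ring.
apply: ler_pM.
- by rewrite !mulr_ge0 ?cmod_ge0 ?exprn_ge0 ?cmod_ge0 ?ltW.
- by rewrite mulr_ge0 ?cmod_ge0 ?exprn_ge0 ?ltW.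
- by rewrite ler_wpM2r ?exprn_ge0 ?cmod_ge0.
- exact: H2.
Qed.

Lemma expandableZ b f a : expandable f a -> expandable (fun z => b * f z) a.
Proof. by move=> fa; apply: expandableM => //; exact: expandable_cst. Qed.

Lemma expandableX f a m : expandable f a -> expandable (fun z => f z ^+ m) a.
Proof.
move=> fa; elim: m => [|m IH].
  by under [X in expandable X]eq_fun do rewrite expr0; exact: expandable_cst.
by under [X in expandable X]eq_fun do rewrite exprS; exact: expandableM.
Qed.

Lemma expandable_prod (I : Type) (s : seq I) (P : pred I) (F : I -> C -> C) a :
  (forall i, P i -> expandable (F i) a) ->
  expandable (fun z => \prod_(i <- s | P i) F i z) a.
Proof.
move=> Fa; elim: s => [|i s IH].
  by under [X in expandable X]eq_fun do rewrite big_nil; exact: expandable_cst.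
under [X in expandable X]eq_fun do rewrite big_cons.
by have [Pi|//] := boolP (P i); apply: expandableM => //; exact: Fa.
Qed.

Lemma expandable_sum (I : Type) (s : seq I) (P : pred I) (F : I -> C -> C) a :
  (forall i, P i -> expandable (F i) a) ->
  expandable (fun z => \sum_(i <- s | P i) F i z) a.
Proof.
move=> Fa; elim: s => [|i s IH].
  by under [X in expandable X]eq_fun do rewrite big_nil; exact: expandable_cst.
under [X in expandable X]eq_fun do rewrite big_cons.
by have [Pi|//] := boolP (P i); apply: expandableD => //; exact: Fa.
Qed.

Lemma expandable_det m (A : C -> 'M[C]_m) a :
  (forall i j, expandable (fun z => A z i j) a) -> expandable (fun z => \det (A z)) a.
Proof.
move=> Aa; apply: expandable_sum => s _; apply: expandableZ.
exact: expandable_prod.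
Qed.

(** This is the geometric series in [- q * w / D], whose remainder of order [n] is exactly
    [(- q * w / D) ^+ n / E]. *)
Lemma expandable_affine_inv b q a : b + q * a != 0 ->
  expandable (fun z => (b + q * z)^-1) a.
Proof.
set D := b + q * a => D0; have d0 : 0 < cmod D by rewrite cmod_gt0.
have q0 := cmod_ge0 q; have q10 : 0 < cmod q + 1 by lra.
(* The radius makes [cmod (q * w)] at most half of [cmod D], which keeps [E] away from 0; the added
   1 covers [q = 0]. *)
set r := cmod D / (2 * (cmod q + 1)).
have r0 : 0 < r by rewrite divr_gt0 // mulr_gt0.
have qr : cmod q * r <= cmod D / 2.
  by rewrite /r ler_pdivlMr // mulrA mulrAC ler_pdivrMr ?mulr_gt0 //; nra.
exists (fun k => (- q) ^+ k / D ^+ k.+1), r, (2 / cmod D); split=> // n w wr.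
have w0 := cmod_ge0 w; set E := b + q * (a + w).
have EE : E = D + q * w by rewrite /E /D; ring.
have dE : cmod D / 2 <= cmod E.
  have : cmod D <= cmod E + cmod (q * w).
    by have -> : D = E - q * w by [rewrite EE; ring]; exact: cmodB.
  by rewrite cmodM; nra.
have E0 : E != 0 by rewrite -cmod_gt0; lra.
have -> : E^-1 - \sum_(k < n) (- q) ^+ k / D ^+ k.+1 * w ^+ k =
   (- q * w / D) ^+ n / E.
  elim: n => [|n IH]; first by rewrite big_ord0 subr0 expr0 mul1r.
  rewrite big_ord_recr /= opprD addrA IH !exprS !expr_div_n !exprMn EE.
  by field; rewrite -EE E0 expf_neq0 // D0.
rewrite cmodM cmodX !cmodM !cmodV cmodN mulrAC -exprMn.
have -> : 2 / cmod D * cmod w ^+ n = cmod w ^+ n * (2 / cmod D) by rewrite mulrC.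
apply: ler_pM.
- by apply: exprn_ge0; rewrite mulr_ge0 ?divr_ge0 ?mulr_ge0 // ltW.
- by rewrite invr_ge0 cmod_ge0.
- apply: lerXn2r; rewrite ?nnegrE //.
    by rewrite mulr_ge0 ?divr_ge0 ?mulr_ge0 // ltW.
  have -> : cmod q * cmod w * (cmod D)^-1 * r = cmod w * (cmod q * r / cmod D) by ring.
  by rewrite ler_piMr // ler_pdivrMr // mul1r; lra.
- by rewrite -invf_div lef_pV2 ?posrE ?divr_gt0 //; lra.
Qed.

Lemma expandable_continuous f a : expandable f a -> continuousC_at f a.
Proof.
move=> [c [r [M H]]] e e0; have M0 := expansion_ge0 H; have fa := expansion_center H.
have [r0 h] := H.
have er : 0 < e * r / (M + 1) by rewrite divr_gt0 ?mulr_gt0 //; lra.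
exists (Num.min r (e * r / (M + 1))); first by rewrite lt_min r0.
move=> z; rewrite lt_min => /andP[zr ze].
have := h 1%N _ (ltW zr); rewrite big_ord1 expr0 !expr1 mulr1 (addrC a) subrK -fa => hz.
move: ze; rewrite ltr_pdivlMr => [ze|]; last by lra.
have := cmod_ge0 (z - a); rewrite -(ltr_pM2r r0); nra.
Qed.

End Expandable.

(** * Termwise differentiation and the order of a zero *)

Section DerivativeAndOrder.
Variable R : realType.
Local Notation C := R[i].
Local Notation D f := (derive1 (f : (C : numFieldType) -> (C : numFieldType))).
Implicit Types (f g : C -> C) (z w a l : C) (u c d : nat -> C).

Lemma near_at_self (P : C -> Prop) a : near_at a P -> P a.
Proof. by move=> /near_cmodP[e e0]; apply; rewrite subrr cmod0. Qed.

Lemma near_atS (P Q : C -> Prop) a : (forall z, P z -> Q z) ->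
  near_at a P -> near_at a Q.
Proof. by move=> PQ; rewrite /near_at; apply: filterS. Qed.

Lemma near_atS2 (P Q S : C -> Prop) a : (forall z, P z -> Q z -> S z) ->
  near_at a P -> near_at a Q -> near_at a S.
Proof. by move=> PQ; rewrite /near_at; apply: filterS2. Qed.

Lemma near_atW (P : C -> Prop) a : (forall z, P z) -> near_at a P.
Proof. by move=> h; apply/near_cmodP; exists 1 => // z _; exact: h. Qed.

Lemma near_at_all (I : finType) (P : I -> C -> Prop) a :
  (forall i, near_at a (P i)) -> near_at a (fun z => forall i, P i z).
Proof. exact: near_forall. Qed.

Lemma near_at_near (P : C -> Prop) a : near_at a P -> near_at a (fun b => near_at b P).
Proof.
move=> /near_cmodP[e e0 h]; apply/near_cmodP; exists e => // z ze.
apply/near_cmodP; exists (e - cmod (z - a)); first by rewrite subr_gt0.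
move=> x xz; apply: h; have -> : x - a = (x - z) + (z - a) by ring.
by apply: (le_lt_trans (cmodD _ _)); lra.
Qed.

(* Second order Taylor remainder of a monomial; the factor [4 ^+ k] absorbs
   the [k ^ 2] of the sharp bound. *)
Lemma monomial_taylor w h (rho : R) k : cmod (w + h) <= rho -> cmod w <= rho ->
  cmod ((w + h) ^+ k - w ^+ k - k%:R * w ^+ k.-1 * h) * rho ^+ 2
  <= cmod h ^+ 2 * (4 * rho) ^+ k.
Proof.
move=> whr wr; have rho0 : 0 <= rho by apply: le_trans wr; exact: cmod_ge0.
elim: k => [|k IH].
  rewrite !expr0 subrr mul0r mul0r subrr cmod0 mul0r mulr1.
  by rewrite exprn_ge0 ?cmod_ge0.
set A := (w + h) ^+ k - _ - _ in IH.
have -> : (w + h) ^+ k.+1 - w ^+ k.+1 - k.+1%:R * w ^+ k.+1.-1 * h =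
    (w + h) * A + k%:R * w ^+ k.-1 * h ^+ 2.
  by rewrite /A; clear; case: k => [|k]; rewrite /= -?natr1 !exprS ?expr0; ring.
apply: (le_trans (ler_wpM2r (exprn_ge0 _ rho0) (cmodD _ _))).
rewrite mulrDl.
have h1 : cmod ((w + h) * A) * rho ^+ 2 <= rho * (cmod h ^+ 2 * (4 * rho) ^+ k).
  rewrite cmodM -mulrA; apply: ler_pM => //; rewrite ?cmod_ge0 //.
  by rewrite mulr_ge0 ?cmod_ge0 ?exprn_ge0.
have h2 : cmod (k%:R * w ^+ k.-1 * h ^+ 2) * rho ^+ 2 <=
    rho * (cmod h ^+ 2 * (4 * rho) ^+ k).
  clear h1 IH; clear A; case: k => [|k].
    rewrite !mul0r cmod0 mul0r mulr_ge0 // mulr_ge0 ?exprn_ge0 ?cmod_ge0 //.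
    by rewrite mulr_ge0.
  have -> : cmod (k.+1%:R * w ^+ k.+1.-1 * h ^+ 2) * rho ^+ 2 =
    cmod h ^+ 2 * (k.+1%:R * cmod w ^+ k * rho ^+ 2).
    by rewrite !cmodM !cmodX cmod_nat /=; ring.
  rewrite [leRHS]mulrCA; apply: ler_wpM2l; first by rewrite exprn_ge0 ?cmod_ge0.
  have -> : rho * (4 * rho) ^+ k.+1 = 4 ^+ k.+1 * rho ^+ k * rho ^+ 2.
    by rewrite exprMn !exprS; ring.
  rewrite ler_wpM2r ?exprn_ge0 //; apply: ler_pM; rewrite ?exprn_ge0 ?cmod_ge0 //.
    apply: (@le_trans _ _ (2 ^+ k.+1)).
      by apply: le_trans (succ_le_exp2 R k.+1); rewrite ler_nat.
    by rewrite lerXn2r ?nnegrE // ler_nat.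
  by rewrite lerXn2r ?nnegrE ?cmod_ge0.
apply: (le_trans (lerD h1 h2)).
have -> : cmod h ^+ 2 * (4 * rho) ^+ k.+1 = 4 * (rho * (cmod h ^+ 2 * (4 * rho) ^+ k)).
  by rewrite [(4 * rho) ^+ _]exprS; ring.
have : 0 <= rho * (cmod h ^+ 2 * (4 * rho) ^+ k).
  rewrite mulr_ge0 // mulr_ge0 ?exprn_ge0 ?cmod_ge0 //.
  by rewrite mulr_ge0.
lra.
Qed.

(** The factor [k + 1] of the derived series costs only a halving of the radius, by [succ_le_exp2].
    That its sum [g] is the derivative follows from a bound quadratic in [h] on [f (a + w + h) - f
    (a + w) - h * g (a + w)], obtained monomial by monomial and passed to the limit. *)
Lemma expansion_deriv f a c r M : power_expansion f a c r M ->
  exists g M', power_expansion g a (fun k => k.+1%:R * c k.+1) (r / 4) M' /\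
    forall w, cmod w < r / 8 ->
      is_derive ((a + w : C) : (C : numFieldType)) 1
        (f : (C : numFieldType) -> (C : numFieldType)) (g (a + w)).
Proof.
move=> H; have M0 := expansion_ge0 H; have cM := expansion_coef H; have [r0 _] := H.
have r20 : 0 < r / 2 by rewrite divr_gt0.
have [k|g Hg] := @expansion_of_coef R (fun k => k.+1%:R * c k.+1) (r / 2) (2 * M / r) a r20.
  rewrite cmodM cmod_nat ler_pdivlMr // expr_div_n.
  have -> : k.+1%:R * cmod (c k.+1) * (r ^+ k / 2 ^+ k) * r =
    k.+1%:R / 2 ^+ k * (cmod (c k.+1) * r ^+ k.+1) by rewrite exprS; ring.
  apply: le_trans (cM k.+1); rewrite ler_piMl ?mulr_ge0 ?cmod_ge0 ?exprn_ge0 ?(ltW r0) //.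
  by rewrite ler_pdivrMr ?exprn_gt0 // mul1r succ_le_exp2.
exists g, (2 * (2 * M / r)); have r4 : r / 2 / 2 = r / 4 by field.
rewrite r4 in Hg; split => // w wr.
(* With this choice [4 * rho = r / 2], so the factor [(4 * rho) ^+ k] of [monomial_taylor] meets the
   coefficient bound [2 * M / r ^+ k] in a geometric series of ratio [1/2]. *)
set rho := r / 8; have rho0 : 0 < rho by rewrite divr_gt0.
set M' := 2 * (2 * M / r) in Hg.
have key h : cmod h < rho - cmod w ->
    cmod (f (a + (w + h)) - f (a + w) - h * g (a + w)) * rho ^+ 2 <= 4 * M * cmod h ^+ 2.
  move=> hr; have wh : cmod (w + h) <= rho.
    by apply: (le_trans (cmodD _ _)); lra.
  have h0 := cmod_ge0 h.
  (* The constant term has no derivative, so [n + 1] terms of the series of [f] go with [n] terms of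
     that of [g]. *)
  pose S n := \sum_(k < n.+1) c k * ((w + h) ^+ k - w ^+ k - k%:R * w ^+ k.-1 * h).
  have SE n : S n = \sum_(k < n.+1) c k * (w + h) ^+ k - \sum_(k < n.+1) c k * w ^+ k
      - h * \sum_(k < n) k.+1%:R * c k.+1 * w ^+ k.
    rewrite /S mulr_sumr; under eq_bigr do rewrite !mulrBr.
    rewrite !sumrB; congr (_ - _).
    rewrite big_ord_recl /= !mul0r mulr0 add0r; apply: eq_bigr => i _.
    by rewrite /bump /= ?add1n; ring.
  have Sb n : cmod (S n) <= 4 * M / rho ^+ 2 * cmod h ^+ 2.
    rewrite mulrAC ler_pdivlMr ?exprn_gt0 //.
    apply: (@le_trans _ _ (\sum_(k < n.+1) 2 * M * 2^-1 ^+ k * cmod h ^+ 2)).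
      apply: (le_trans (ler_wpM2r (exprn_ge0 _ (ltW rho0)) (cmod_sum _ _ _))).
      rewrite mulr_suml; apply: ler_sum => k _; rewrite cmodM -[leLHS]mulrA.
      have := monomial_taylor k wh (ltW wr) => /(ler_wpM2l (cmod_ge0 (c k))) /le_trans; apply.
      have -> : 4 * rho = r / 2 by rewrite /rho; field.
      rewrite exprMn mulrCA mulrC ler_wpM2r ?exprn_ge0 //.
      by rewrite mulrA ler_wpM2r ?exprn_ge0.
    have -> : 4 * M * cmod h ^+ 2 = 2 * M * cmod h ^+ 2 * 2 by ring.
    under eq_bigr do rewrite mulrAC.
    rewrite -mulr_sumr; apply: ler_wpM2l; first by rewrite !mulr_ge0 ?exprn_ge0.
    suff -> : \sum_(k < n.+1) 2^-1 ^+ k = 2 - 2^-1 ^+ n :> R.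
      by rewrite gerBl exprn_ge0.
    elim: n {SE} => [|n IH]; first by rewrite big_ord1 !expr0; lra.
    by rewrite big_ord_recr /= IH exprS; field.
  rewrite -ler_pdivlMr ?exprn_gt0 // [leRHS]mulrAC -[X in cmod X]subr0.
  apply: (@cmod_limit_le _ S _ _ _ 0%N) => [|m _]; last by rewrite subr0.
  apply: (squeeze_cvgr _ (cvg_cst 0) (cvg_half (M + M + cmod h * M'))).
  apply: nearW => n; rewrite cmod_ge0 /= SE.
  set F1 := f (a + (w + h)); set F2 := f (a + w); set G := g (a + w).
  set S1 := \sum_(k < _) _; set S2 := \sum_(k < _) _; set S3 := \sum_(k < _) _.
  have -> : S1 - S2 - h * S3 - (F1 - F2 - h * G) = - (F1 - S1) + (F2 - S2) + h * (G - S3).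
    by ring.
  apply: (le_trans (cmodD _ _)); rewrite mulrDl cmodM -mulrA; apply: lerD; last first.
    by apply: ler_wpM2l => //; apply: (expansion_half _ Hg); rewrite /rho in wr; lra.
  apply: (le_trans (cmodD _ _)); rewrite cmodN mulrDl; apply: lerD.
    apply: (@le_trans _ _ (M * 2^-1 ^+ n.+1)).
      by apply: (expansion_half _ H); rewrite /rho in wh; lra.
    by rewrite ler_wpM2l // exprS ler_piMl ?exprn_ge0 //; lra.
  apply: (@le_trans _ _ (M * 2^-1 ^+ n.+1)).
    by apply: (expansion_half _ H); rewrite /rho in wr; lra.
  by rewrite ler_wpM2l // exprS ler_piMl ?exprn_ge0 //; lra.
apply: is_derive_cmod => e e0.
set K := 4 * M / rho ^+ 2 + 1.
have K0 : 0 < K by rewrite ltr_wpDl // divr_ge0 ?exprn_ge0 ?mulr_ge0 // ltW.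
exists (Num.min (rho - cmod w) (e / K)).
  by rewrite lt_min subr_gt0 wr divr_gt0.
move=> h hn0; rewrite lt_min => /andP[/key hk he].
have h0 : 0 < cmod h by rewrite cmod_gt0.
have -> : (f (h + (a + w)) - f (a + w)) / h - g (a + w) =
    (f (a + (w + h)) - f (a + w) - h * g (a + w)) / h.
  by rewrite (addrC h) addrA; field.
rewrite cmodM cmodV ltr_pdivrMr //.
move: hk; rewrite -ler_pdivlMr ?exprn_gt0 // => /le_lt_trans; apply.
move: he; rewrite ltr_pdivlMr // => he.
rewrite mulrAC expr2 mulrA ltr_pM2r //; apply: le_lt_trans he.
by rewrite mulrC ler_wpM2l ?cmod_ge0 // /K lerDl.
Qed.

Lemma expandable_deriv f a : expandable f a -> expandable (D f) a.
Proof.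
move=> [c [r [M H]]]; have [g [M' [Hg fg]]] := expansion_deriv H.
have r0 : 0 < r by case: H.
apply: (@expandable_near _ g); last by exists (fun k => k.+1%:R * c k.+1), (r / 4), M'.
apply/near_cmodP; exists (r / 8); first by rewrite divr_gt0.
by move=> z /fg; rewrite (addrC a) subrK derive1E => -[_ ->].
Qed.

Lemma expandable_is_derive f a : expandable f a ->
  near_at a (fun z => is_derive (z : (C : numFieldType)) 1
    (f : (C : numFieldType) -> (C : numFieldType)) ((D f) z)).
Proof.
move=> [c [r [M H]]]; have [g [M' [Hg fg]]] := expansion_deriv H.
have r0 : 0 < r by case: H.
apply/near_cmodP; exists (r / 8); first by rewrite divr_gt0.
move=> z /fg; rewrite (addrC a) subrK => fz.
by split; [case: fz|rewrite derive1E].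
Qed.

Lemma expandable_derive1n f a i : expandable f a ->
  expandable (derive1n i (f : (C : numFieldType) -> (C : numFieldType))) a.
Proof.
move=> fa; elim: i => [|i IH] //.
by rewrite derive1nS; exact: expandable_deriv.
Qed.

Lemma near_derive1n f g a i : near_at a (fun z => f z = g z) ->
  near_at a (fun z => derive1n i (f : (C : numFieldType) -> (C : numFieldType)) z =
    derive1n i (g : (C : numFieldType) -> (C : numFieldType)) z).
Proof.
move=> fg; elim: i => [|i IH] //; rewrite !derive1nS.
by apply: near_atS (near_at_near IH) => z; exact: near_derive1.
Qed.

(** Off [a], dividing the remainder of order [n + 1] by [w] already gives the constant [M / r]. The
    factor 2 is for the value [c 1] at [a] itself, bounded by [expansion_coef]. *)
Lemma expansion_shift f a c r M : power_expansion f a c r M -> f a = 0 ->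
  exists g, power_expansion g a (fun k => c k.+1) r (2 * M / r) /\
    forall z, f z = (z - a) * g z.
Proof.
move=> H fa; have M0 := expansion_ge0 H; have cM := expansion_coef H; have [r0 h] := H.
have c0 : c 0%N = 0 by rewrite -(expansion_center H).
exists (fun z => if z == a then c 1%N else f z / (z - a)); split; last first.
  move=> z; case: eqP => [->|/eqP za]; first by rewrite subrr mul0r.
  by rewrite mulrC divfK // subr_eq0.
have M20 : 0 <= 2 * M / r by rewrite divr_ge0 ?mulr_ge0 // ltW.
split=> // n w wr; case: eqP => [/eqP|/eqP] aw.
  have w0 : w = 0 by apply/eqP; rewrite -(inj_eq (addrI a)) addr0.
  rewrite w0 cmod0; case: n => [|n].
    by rewrite big_ord0 subr0 !expr0 !mulr1 ler_pdivlMr //; exact: cM 1%N.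
  rewrite big_ord_recl big1 => [|i _]; last by rewrite /= expr0n mulr0.
  by rewrite expr0 mulr1 addr0 subrr cmod0 mul0r mulr_ge0 ?exprn_ge0.
have w0 : w != 0 by apply: contraNneq aw => ->; rewrite addr0.
have cw : 0 < cmod w by rewrite cmod_gt0.
have := h n.+1 w wr; rewrite big_ord_recl c0 mul0r add0r.
have -> : f (a + w) - \sum_(i < n) c (bump 0 i) * w ^+ (bump 0 i) =
   w * (f (a + w) / (a + w - a) - \sum_(k < n) c k.+1 * w ^+ k).
  rewrite mulrBr mulr_sumr addrAC subrr add0r mulrC divfK //; congr (_ - _).
  by apply: eq_bigr => i _; rewrite /bump /= add1n exprS; ring.
rewrite cmodM; set X := cmod (_ - _) => hX.
rewrite mulrAC ler_pdivlMr // -(ler_pM2l cw).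
have -> : cmod w * (X * r ^+ n * r) = cmod w * X * r ^+ n.+1 by rewrite exprS; ring.
apply: (le_trans hX).
have -> : cmod w * (2 * M * cmod w ^+ n) = 2 * (M * cmod w ^+ n.+1) by rewrite exprS; ring.
by rewrite ler_peMl ?ler1n // mulr_ge0 ?exprn_ge0 // ltW.
Qed.

Definition has_order f a m := exists g,
  [/\ expandable g a, g a != 0 & near_at a (fun z => f z = (z - a) ^+ m * g z)].

Lemma zero_orderP f a m :
  zero_order (f : (C : numFieldType) -> (C : numFieldType)) a m <-> has_order f a m.
Proof.
by split=> -[g [ga g0 h]]; exists g; split=> //; exact/analytic_atP.
Qed.

(** If all coefficients vanish, so do the partial sums and their limits near [a]. Otherwise the
    index [m] of a nonzero coefficient bounds the number of divisions by [z - a] that can occur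
    before the value at [a] becomes nonzero; [m] need not be the order. *)
Lemma expandable_order f a : expandable f a ->
  near_at a (fun z => f z = 0) \/ exists m, has_order f a m.
Proof.
move=> [c [r [M H]]].
have [[m cm]|] := pselect (exists m, c m != 0); last first.
  move=> c0; left; have {}c0 k : c k = 0.
    by apply/eqP; apply: contrapT => /negP ck; apply: c0; exists k.
  have r0 : 0 < r by case: H.
  apply/near_cmodP; exists (r / 2); first by rewrite divr_gt0.
  move=> z zr; apply: (cmod_limit_unique (u := fun=> 0)).
    have := expansion_cvg H (ltW zr); rewrite (addrC a) subrK.
    rewrite (_ : (fun n => _) = fun=> cmod (0 - f z)) //; apply/funext => n.
    by rewrite big1 // => i _; rewrite c0 mul0r.
  by rewrite subrr cmod0; exact: cvg_cst.
right; elim: m f c M H cm => [|m IH] f c M H cm.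
  exists 0%N, f; split; first by exists c, r, M.
    by rewrite (expansion_center H).
  by apply: near_atW => z; rewrite expr0 mul1r.
have [fa|fa] := eqVneq (f a) 0; last first.
  exists 0%N, f; split => //; first by exists c, r, M.
  by apply: near_atW => z; rewrite expr0 mul1r.
have [g [Hg fg]] := expansion_shift H fa.
have [m' [h [ha h0 gh]]] := IH g _ _ Hg cm.
exists m'.+1, h; split=> //; apply: near_atS gh => z gz.
by rewrite fg gz exprS mulrA.
Qed.

End DerivativeAndOrder.

(** * Orders of zeros and the closed disk *)

Section Orders.
Variable R : realType.
Local Notation C := R[i].
Implicit Types (f g h : C -> C) (z w a b l : C) (m n : nat).

Lemma expandable_punctured_zero h a : expandable h a ->
  near_at a (fun z => z != a -> h z = 0) -> h a = 0.
Proof.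
move=> /expandable_continuous hc /near_cmodP[e e0 hz].
apply/eqP; apply: contraT => ha; have ca : 0 < cmod (h a) by rewrite cmod_gt0.
have [d d0 hd] := hc _ ca; set x := Num.min d e / 2.
have m0 : 0 < Num.min d e by rewrite lt_min d0 e0.
have x0 : 0 < x by rewrite divr_gt0.
have xx : x < Num.min d e by rewrite /x; lra.
have cx : cmod (a + (x%:C)%C - a) = x by rewrite addrAC subrr add0r cmod_real gtr0_norm.
move: xx; rewrite lt_min => /andP[xd xe].
have := hd (a + (x%:C)%C); rewrite cx => /(_ xd).
rewrite hz ?cx // ?sub0r ?cmodN ?ltxx //.
by rewrite -subr_eq0 -cmod_gt0 cx.
Qed.

(** If [n > m], cancelling [(z - a) ^+ m] off [a] and extending by continuity gives [g a = 0]. As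
    [h] may vanish at [a], this turns mere divisibility into a bound on the order. *)
Lemma order_ge f g h a m n : expandable g a -> g a != 0 -> expandable h a ->
  near_at a (fun z => f z = (z - a) ^+ m * g z) ->
  near_at a (fun z => f z = (z - a) ^+ n * h z) -> (n <= m)%N.
Proof.
move=> ga g0 ha fg fh; rewrite leqNgt; apply: contra g0 => mn.
have k0 : (0 < n - m)%N by rewrite subn_gt0.
suff : g a + - 1 * ((a - a) ^+ (n - m) * h a) = 0.
  by rewrite subrr expr0n eqn0Ngt k0 mul0r mulr0 addr0 => ->.
apply: (@expandable_punctured_zero (fun z => g z + -1 * ((z - a) ^+ (n - m) * h z))).
  apply: expandableD => //; apply: expandableZ; apply: expandableM => //.
  apply: expandableX; apply: expandableD; [exact: expandable_id|exact: expandable_cst].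
apply: near_atS2 fg fh => z -> fh za.
have z0 : (z - a) ^+ m != 0 by rewrite expf_neq0 // subr_eq0.
apply: (mulfI z0); rewrite mulr0 mulrDr fh -{1}(subnKC (ltnW mn)) exprD; ring.
Qed.

Lemma order_unique f a m n : has_order f a m -> has_order f a n -> m = n.
Proof.
move=> [g [ga g0 fg]] [h [ha h0 fh]]; apply/eqP; rewrite eqn_leq.
by rewrite (order_ge ha h0 ga fh fg) (order_ge ga g0 ha fg fh).
Qed.

Lemma mult_order f a m : has_order f a m ->
  mult (f : (C : numFieldType) -> (C : numFieldType)) a = m.
Proof.
move=> fm; apply: xget_unique; first exact/zero_orderP.
by move=> n /zero_orderP fn; exact: order_unique fn fm.
Qed.

Lemma has_order_near f g a m : near_at a (fun z => f z = g z) ->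
  has_order f a m -> has_order g a m.
Proof.
move=> fg [h [ha h0 fh]]; exists h; split => //.
by apply: near_atS2 fg fh => z ->.
Qed.

Lemma has_order0 f a : expandable f a -> f a != 0 -> has_order f a 0.
Proof.
by move=> fa f0; exists f; split => //; apply: near_atW => z; rewrite expr0 mul1r.
Qed.

Lemma has_orderM f g a m n : has_order f a m -> has_order g a n ->
  has_order (fun z => f z * g z) a (m + n).
Proof.
move=> [f1 [fa f0 ff]] [g1 [ga g0 gg]]; exists (fun z => f1 z * g1 z).
split; [exact: expandableM|by rewrite mulf_neq0|].
by apply: near_atS2 ff gg => z -> ->; rewrite exprD; ring.
Qed.

Lemma has_orderX f a m n : has_order f a m -> has_order (fun z => f z ^+ n) a (m * n).
Proof.
move=> fm; elim: n => [|n IH].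
  rewrite muln0; apply: has_order0; last by rewrite expr0 oner_eq0.
  by under [X in expandable X]eq_fun do rewrite expr0; exact: expandable_cst.
rewrite mulnS; under [X in has_order X]eq_fun do rewrite exprS; exact: has_orderM.
Qed.

Lemma has_order_prod (I : eqType) (s : seq I) (F : I -> C -> C) (m : I -> nat) a :
  (forall i, i \in s -> has_order (F i) a (m i)) ->
  has_order (fun z => \prod_(i <- s) F i z) a (\sum_(i <- s) m i).
Proof.
elim: s => [|i s IH] Fm.
  rewrite big_nil; apply: has_order0; last by rewrite big_nil oner_eq0.
  by under [X in expandable X]eq_fun do rewrite big_nil; exact: expandable_cst.
rewrite big_cons; under [X in has_order X]eq_fun do rewrite big_cons.
apply: has_orderM; first by apply: Fm; rewrite mem_head.
by apply: IH => j js; apply: Fm; rewrite inE js orbT.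
Qed.

Lemma has_order_expandable f a m : has_order f a m -> expandable f a.
Proof.
move=> [g [ga _ fg]]; apply: (@expandable_near _ (fun z => (z - a) ^+ m * g z)).
  by apply: near_atS fg.
apply: expandableM => //; apply: expandableX.
by apply: expandableD; [exact: expandable_id|exact: expandable_cst].
Qed.

Lemma has_order_isolated f a m : has_order f a m ->
  near_at a (fun z => z != a -> f z != 0).
Proof.
move=> [g [/expandable_continuous gc g0 fg]].
have : near_at a (fun z => g z != 0).
  have [|d d0 hd] := gc (cmod (g a)); first by rewrite cmod_gt0.
  apply/near_cmodP; exists d => // z /hd; apply: contraTneq => ->.
  by rewrite sub0r cmodN ltxx.
apply: near_atS2 fg => z -> gz za.
by rewrite mulf_neq0 // expf_neq0 // subr_eq0.
Qed.

(** The zero function is divisible by [(z - a) ^+ m.+1], which [order_ge] excludes. *)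
Lemma has_order_not_near0 f a m : has_order f a m -> ~ near_at a (fun z => f z = 0).
Proof.
move=> [g [ga g0 fg]] f0.
suff : (m.+1 <= m)%N by rewrite ltnn.
apply: (@order_ge f g (fun=> 0) a) => //; first exact: expandable_cst.
by apply: near_atS f0 => z ->; rewrite mulr0.
Qed.

(** The default value of [mult] is 0, so a positive value comes from a genuine factorization. *)
Lemma mult_gt0_root f a :
  (0 < mult (f : (C : numFieldType) -> (C : numFieldType)) a)%N -> f a = 0.
Proof.
rewrite /mult; case: xgetP => // m -> /zero_orderP[g [_ _ /near_at_self ->]] m0.
by rewrite subrr expr0n eqn0Ngt m0 mul0r.
Qed.

End Orders.

(** * Compactness of the closed disk and extremal arguments *)

Section ClosedDisk.
Variable R : realType.
Local Notation C := R[i].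
Local Notation cdisk := (@closed_disk R).
Implicit Types (f g h : C -> C) (z w a b l : C) (A B : C -> Prop).

Lemma cdisk0 : cdisk 0.
Proof. by rewrite /closed_disk /mkset cmod0. Qed.

(** Compactness in the form of an induction over sets. If [Q] failed for the disk, the sets whose
    complement in the disk satisfies [Q] would form a proper filter; it lives on the square of pairs
    (real part, imaginary part), a product of two segments, and [Q] on a neighbourhood of a cluster
    point contradicts clustering. *)
Lemma disk_induction (Q : (C -> Prop) -> Prop) :
  (forall A B, Q A -> Q B -> Q (fun z => A z \/ B z)) ->
  (forall A B, Q B -> (forall z, A z -> B z) -> Q A) ->
  (forall a, cdisk a -> exists2 e : R, 0 < e & Q (fun z => cmod (z - a) < e)) ->
  Q cdisk.
Proof.
move=> QU Qsub Qloc; have Q0 : Q (fun=> False).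
  have [e e0 Qe] := Qloc 0 cdisk0.
  by apply: (Qsub _ _ Qe).
apply: contrapT => nQ.
pose F : set_system (R * R) :=
  fun S => Q (fun z => cdisk z /\ ~ S (complex.Re z, complex.Im z)).
have FF : ProperFilter F.
  split; first by move=> FQ; apply: nQ; apply: (Qsub _ _ FQ) => z Dz; split => //; case.
  split; first by apply: (Qsub _ _ Q0) => z [_ h]; apply: h.
    move=> S T FS FT; apply: (Qsub _ _ (QU _ _ FS FT)) => z [Dz nST].
    have [Sz|nS] := pselect (S (complex.Re z, complex.Im z)); last by left.
    by right; split => // Tz; apply: nST.
  by move=> S T ST FS; apply: (Qsub _ _ FS) => z [Dz nT]; split => // /ST.
have sqc : compact (`[(-1 : R), 1] `*` `[(-1 : R), 1]).
  by apply: compact_setX; exact: segment_compact.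
have Fsq : F (`[(-1 : R), 1] `*` `[(-1 : R), 1]).
  apply: (Qsub _ _ Q0) => z [Dz]; apply; rewrite /= !in_itv /= -!ler_norml.
  by split; [apply: le_trans (cmod_Re _) Dz|apply: le_trans (cmod_Im _) Dz].
have [[x y] [_ cl]] := sqc F FF Fsq.
(* The cluster point lies in the square but perhaps not in the disk; in that case a ball around it
   misses the disk, and [Q] of the empty set suffices. *)
have [e e0 Qe] : exists2 e : R, 0 < e & Q (fun z => cdisk z /\ cmod (z - (x +i* y)%C) < e).
  have [Da|nD] := pselect (cdisk (x +i* y)%C).
    by have [e e0 Qe] := Qloc _ Da; exists e => //; apply: (Qsub _ _ Qe) => z [].
  exists (cmod (x +i* y)%C - 1).
    by rewrite subr_gt0 ltNge; apply/negP.
  apply: (Qsub _ _ Q0) => z [Dz]; rewrite cmodC ltrBrDl.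
  have := cmodD (x +i* y - z)%C z; rewrite subrK => h1 h2; move: Dz; rewrite /closed_disk /=.
  lra.
set B : set (R * R) := [set u | cmod ((u.1 +i* u.2) - (x +i* y))%C < e].
have nB : nbhs (x, y) B.
  apply/nbhs_ballP; exists (e / 2); first by rewrite /= divr_gt0.
  move=> [x' y'] [/= hx hy]; change (cmod ((x' +i* y') - (x +i* y))%C < e).
  apply: (le_lt_trans (cmod_le_ReIm _)) => /=.
  move: hx hy; rewrite /ball /= distrC => hx; rewrite distrC => hy.
  by lra.
have FB : F (~` B).
  by apply: (Qsub _ _ Qe) => -[u v] [Dz /contrapT]; rewrite /B /=.
by have [u []] := cl _ _ FB nB.
Qed.

(** Without a maximum, each point of [S] has a neighbourhood where [phi] stays below its value at
    some other point of [S], and each point off [S] has one that misses [S]. Keeping the better of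
    two competitors, [disk_induction] produces a point of [S] dominating all of [S]. *)
Lemma disk_argmax (S : C -> Prop) (phi : C -> R) :
  (exists a, S a) -> (forall a, S a -> cdisk a) ->
  (forall a, cdisk a -> ~ S a -> near_at a (fun z => ~ S z)) ->
  (forall a y, S a -> phi a < y -> near_at a (fun z => phi z < y)) ->
  exists2 a, S a & forall b, S b -> phi b <= phi a.
Proof.
move=> [a0 Sa0] SD Scl phic; apply: contrapT => nmax.
suff : exists2 b, S b & forall z, cdisk z -> S z -> phi z <= phi b.
  by move=> [b Sb hb]; apply: nmax; exists b => // z Sz; apply: hb => //; exact: SD.
apply: (@disk_induction (fun A => exists2 b, S b & forall z, A z -> S z -> phi z <= phi b)).
- move=> A B [b Sb hb] [c Sc hc].
  have [bc|/ltW cb] := leP (phi b) (phi c).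
    by exists c => // z [Az Sz|Bz Sz]; [apply: le_trans bc; exact: hb|exact: hc].
  by exists b => // z [Az Sz|Bz Sz]; [exact: hb|apply: le_trans cb; exact: hc].
- by move=> A B [b Sb hb] AB; exists b => // z /AB; exact: hb.
move=> a Da; have [Sa|nSa] := pselect (S a).
  have [b Sb ab] : exists2 b, S b & phi a < phi b.
    apply: contrapT => nb; apply: nmax; exists a => // b Sb; rewrite leNgt.
    by apply/negP => ab; apply: nb; exists b.
  have /near_cmodP[e e0 h] := phic _ _ Sa ab.
  by exists e => //; exists b => // z /h /ltW.
have /near_cmodP[e e0 h] := Scl _ Da nSa.
by exists e => //; exists a0 => // z /h.
Qed.

Lemma near_cmod_lt f a y : continuousC_at f a -> cmod (f a) < y ->
  near_at a (fun z => cmod (f z) < y).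
Proof.
move=> fc fy; have [|d d0 h] := fc (y - cmod (f a)); first by rewrite subr_gt0.
apply/near_cmodP; exists d => // z /h hz.
have -> : f z = (f z - f a) + f a by ring.
by apply: (le_lt_trans (cmodD _ _)); lra.
Qed.

Lemma near_cmod_gt f a y : continuousC_at f a -> y < cmod (f a) ->
  near_at a (fun z => y < cmod (f z)).
Proof.
move=> fc fy; have [|d d0 h] := fc (cmod (f a) - y); first by rewrite subr_gt0.
apply/near_cmodP; exists d => // z /h hz.
have : cmod (f a) <= cmod (f z) + cmod (f z - f a).
  by have {1}-> : f a = f z - (f z - f a) by [ring]; exact: cmodB.
lra.
Qed.

Lemma continuousC_id a : continuousC_at id a.
Proof. by move=> e e0; exists e. Qed.

Lemma disk_bounded f : (forall a, cdisk a -> expandable f a) ->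
  exists M, forall z, cdisk z -> cmod (f z) <= M.
Proof.
move=> fD; have [||||a _ h] := @disk_argmax cdisk (fun z => cmod (f z)); last by exists (cmod (f a)).
- by exists 0; exact: cdisk0.
- by [].
- by [].
- by move=> a y /fD /expandable_continuous; exact: near_cmod_lt.
Qed.

(** Contradicts the choice of an interior point of greatest modulus in a set that contains a
    neighbourhood of that point. *)
Lemma exists_farther a (e : R) : cmod a < 1 -> 0 < e ->
  exists b, [/\ cmod (b - a) < e, cmod a < cmod b & cmod b <= 1].
Proof.
move=> a1 e0; have a0 := cmod_ge0 a.
set t := Num.min e (1 - cmod a) / 2.
have m0 : 0 < Num.min e (1 - cmod a) by rewrite lt_min e0 subr_gt0.
have t0 : 0 < t by rewrite divr_gt0.
have : t < Num.min e (1 - cmod a) by rewrite /t; lra.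
rewrite lt_min => /andP[te ta].
have [-> |an0] := eqVneq a 0.
  exists (t%:C)%C; rewrite subr0 cmod0 cmod_real gtr0_norm //; split => //.
  by apply: ltW; lra.
have ca : 0 < cmod a by rewrite cmod_gt0.
exists (((1 + t / cmod a)%:C)%C * a).
have t1 : 0 < t / cmod a by rewrite divr_gt0.
have -> : cmod (((1 + t / cmod a)%:C)%C * a) = cmod a + t.
  by rewrite cmodM cmod_real gtr0_norm; [field; exact: lt0r_neq0|lra].
have -> : ((1 + t / cmod a)%:C)%C * a - a = ((t / cmod a)%:C)%C * a.
  by rewrite rmorphD rmorph1; ring.
by rewrite cmodM cmod_real gtr0_norm // divfK ?lt0r_neq0 //; split => //; lra.
Qed.

(* Near a zero-free point, a nonconstant [f] takes values of smaller modulus: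
   writing [f z = f a + (z - a) ^+ m * g z], move along an m-th root of
   [- f a / g a]. *)
Lemma local_min_modulus f a (e : R) : expandable f a -> f a != 0 -> 0 < e ->
  near_at a (fun z => f z = f a) \/
  exists2 z, cmod (z - a) < e & cmod (f z) < cmod (f a).
Proof.
move=> fa f0 e0.
have : expandable (fun z => f z + - f a) a.
  by apply: expandableD => //; exact: expandable_cst.
move=> /expandable_order[h|[m [g [ga g0 fg]]]].
  by left; apply: near_atS h => z /eqP; rewrite subr_eq0 => /eqP.
right; have m0 : (0 < m)%N.
  rewrite lt0n; apply: contraNneq g0 => m0; have := near_at_self fg.
  by rewrite m0 subrr expr0 mul1r => <-.
set v := - f a / g a; set w := m.-root v.
have wm : w ^+ m = v by rewrite rootCK.
have v0 : v != 0 by rewrite mulf_neq0 ?oppr_eq0 ?invr_eq0.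
have w0 : w != 0 by apply: contraNneq v0; rewrite -wm => ->; rewrite expr0n eqn0Ngt m0.
have cw : 0 < cmod w by rewrite cmod_gt0.
have cg : 0 < cmod (g a) / 2 by rewrite divr_gt0 // cmod_gt0.
have [d1 d10 hg] := expandable_continuous ga cg.
have /near_cmodP[d2 d20 hf] := fg.
(* The bounds [d1], [d2] and [e] keep [z] where the estimates hold; [cmod w] makes [t <= 1]. *)
set d := Num.min (Num.min d1 d2) (Num.min e (cmod w)).
have d0 : 0 < d by rewrite !lt_min d10 d20 e0 cw.
set t := d / cmod w / 2.
have t0 : 0 < t by rewrite !divr_gt0.
have tw : t * cmod w = d / 2 by rewrite /t; field; exact: lt0r_neq0.
have : d / 2 < d by lra.
rewrite {2}/d !lt_min -tw => /andP[/andP[td1 td2] /andP[tde tdw]].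
have t1 : t <= 1 by rewrite -(ler_pM2r cw) mul1r ltW.
set z := a + (t%:C)%C * w.
have za : z - a = (t%:C)%C * w by rewrite /z; ring.
have cz : cmod (z - a) = t * cmod w by rewrite za cmodM cmod_real gtr0_norm.
exists z; first by rewrite cz.
(* The root [w] turns [(z - a) ^+ m * g a] into [- t ^+ m * f a]. The error made by replacing [g z]
   with [g a] is less than half of that, so the second factor has modulus below 1. *)
have fz : f z = f a * ((1 - t ^+ m)%:C%C + (t ^+ m)%:C%C * ((g a - g z) / g a)).
  have := hf z; rewrite cz => /(_ td2) /eqP; rewrite subr_eq => /eqP ->.
  have tE : ((t%:C)%C : C) ^+ m = (t ^+ m)%:C%C by rewrite rmorphXn.
  have t1E : ((1 - t ^+ m)%:C)%C = 1 - (t ^+ m)%:C%C :> C by rewrite rmorphB rmorph1.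
  rewrite za exprMn wm /v tE t1E; move: ((t ^+ m)%:C)%C (f a) (g a) (g z) g0 => T A B G B0.
  by field.
rewrite fz cmodM gtr_pMr ?cmod_gt0 //.
have tm0 : 0 < t ^+ m by rewrite exprn_gt0.
have tm1 : t ^+ m <= 1 by rewrite exprn_ile1 // ltW.
apply: (le_lt_trans (cmodD _ _)); rewrite !cmodM !cmod_real cmodV.
rewrite (gtr0_norm tm0) ger0_norm ?subr_ge0 //.
have : cmod (g a - g z) / cmod (g a) < 2^-1.
  rewrite ltr_pdivrMr ?cmod_gt0 // cmodC.
  by have := hg z; rewrite cz => /(_ td1); lra.
nra.
Qed.

(** Among the points where the modulus of [f] is minimal, one farthest from the origin is taken. If
    it were interior, [local_min_modulus] would either beat the minimum or make [f] constant nearby,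
    and then a minimizer would lie farther out. *)
Lemma min_modulus f : (forall a, cdisk a -> expandable f a) ->
  (forall a, cdisk a -> f a != 0) ->
  forall z, cdisk z -> exists zeta : circle R, cmod (f (val zeta)) <= cmod (f z).
Proof.
move=> fD f0; have fc a Da := expandable_continuous (fD a Da).
have [||||z0 Dz0 hz0] := @disk_argmax cdisk (fun z => - cmod (f z)).
- by exists 0; exact: cdisk0.
- by [].
- by [].
- move=> a y /fc ac ay; have := @near_cmod_gt f a (- y) ac.
  rewrite ltrNl => /(_ ay); apply: near_atS => z.
  by rewrite ltrNl.
pose S z := cdisk z /\ cmod (f z) <= cmod (f z0).
have [||||z1 [Dz1 fz1] hz1] := @disk_argmax S (@cmod R).
- by exists z0.
- by move=> a [].
- move=> a Da nSa; have := @near_cmod_gt f a (cmod (f z0)) (fc _ Da).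
  have fa : cmod (f z0) < cmod (f a).
    by rewrite ltNge; apply/negP => h; apply: nSa.
  by move=> /(_ fa); apply: near_atS => z hz [_]; rewrite leNgt hz.
- by move=> a y _; exact: near_cmod_lt (@continuousC_id a).
move=> z Dz; have z0z : cmod (f z0) <= cmod (f z).
  by have := hz0 _ Dz; rewrite lerN2.
have [z11|] := eqVneq (cmod z1) 1.
  have /eqP z11' := z11.
  by exists (exist _ z1 z11'); exact: le_trans z0z.
move=> z1n; have z1l : cmod z1 < 1 by rewrite lt_neqAle z1n.
have e0 : 0 < 1 - cmod z1 by rewrite subr_gt0.
have [cst|[b bz fb]] := local_min_modulus (fD _ Dz1) (f0 _ Dz1) e0.
  have /near_cmodP[e e1 he] := cst.
  have [b [bz1 b1 b2]] := exists_farther z1l e1.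
  have : S b by split => //; rewrite (he _ bz1).
  by move=> /hz1; rewrite leNgt b1.
have Db : cdisk b.
  rewrite /closed_disk /=; have -> : b = (b - z1) + z1 by ring.
  by apply: (le_trans (cmodD _ _)); lra.
by have := hz0 _ Db; rewrite lerN2; lra.
Qed.

(** The points near which [f] vanishes form a relatively closed set, since zeros near a point of
    finite order are isolated. A farthest such point cannot be interior, and on the circle [f] is
    nonzero. *)
Lemma order_on_disk f : (forall a, cdisk a -> expandable f a) ->
  (forall zeta : circle R, f (val zeta) != 0) ->
  forall a, cdisk a -> exists m, has_order f a m.
Proof.
move=> fD f1 a Da; have [f0|//] := expandable_order (fD a Da); exfalso.
pose S z := cdisk z /\ near_at z (fun x => f x = 0).
have [||||z1 [Dz1 fz1] hz1] := @disk_argmax S (@cmod R).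
- by exists a.
- by move=> b [].
- move=> b Db nSb; have [h|[m fm]] := expandable_order (fD b Db); first by exfalso; apply: nSb.
  apply: near_atS (has_order_isolated fm) => z zb [Dz fz].
  have [zb'|/zb] := eqVneq z b; last by rewrite (near_at_self fz) eqxx.
  by apply: (has_order_not_near0 fm); rewrite -zb'.
- by move=> b y _; exact: near_cmod_lt (@continuousC_id b).
have [z11|] := eqVneq (cmod z1) 1.
  have /eqP z11' := z11.
  by have := f1 (exist _ z1 z11'); rewrite /= (near_at_self fz1) eqxx.
move=> z1n; have z1l : cmod z1 < 1 by rewrite lt_neqAle z1n.
have /near_cmodP[e e1 he] := near_at_near fz1.
have [b [bz1 b1 b2]] := exists_farther z1l e1.
have Sb : S b by split; [exact: b2|exact: he].
by have := hz1 _ Sb; rewrite leNgt b1.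
Qed.

Lemma finite_zeros f : (forall a, cdisk a -> exists m, has_order f a m) ->
  exists s : seq C, forall z, cdisk z -> f z = 0 -> z \in s.
Proof.
move=> fm; apply: (@disk_induction (fun A => exists s : seq C, forall z, A z -> f z = 0 -> z \in s)).
- move=> A B [s hs] [t ht]; exists (s ++ t) => z [Az|Bz] fz; rewrite mem_cat.
    by rewrite hs.
  by rewrite ht ?orbT.
- by move=> A B [s hs] AB; exists s => z /AB; exact: hs.
move=> a /fm[m /has_order_isolated/near_cmodP[e e0 h]]; exists e => //.
exists [:: a] => z /h za fz; rewrite inE; apply: contraT => /za.
by rewrite fz eqxx.
Qed.

End ClosedDisk.

(** * Blaschke products *)

Section Blaschke.
Variable R : realType.
Local Notation C := R[i].
Local Notation cdisk := (@closed_disk R).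
Implicit Types (f g h : C -> C) (z w a b l : C) (m : C -> nat) (s : seq C).

Definition blaschke_factor a z : C := (z - a) / (1 - (a^*)%C * z).

Lemma sqr_cmod z : cmod z ^+ 2 = complex.Re z ^+ 2 + complex.Im z ^+ 2.
Proof. by case: z => x y; rewrite /cmod /= sqr_sqrtr // addr_ge0 ?sqr_ge0. Qed.

(** The sign of the right side gives both the bound by 1 on the closed disk and the modulus 1 on the
    circle. *)
Lemma blaschke_identity a z :
  cmod (1 - (a^*)%C * z) ^+ 2 - cmod (z - a) ^+ 2 =
  (1 - cmod a ^+ 2) * (1 - cmod z ^+ 2).
Proof. by rewrite !sqr_cmod; case: a z => x y [u v] /=; ring. Qed.

Lemma blaschke_den_neq0 a z : disk a -> cdisk z -> 1 - (a^*)%C * z != 0.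
Proof.
rewrite /disk /closed_disk /= => a1 z1; rewrite subr_eq0; apply: contraTneq z1 => e.
have : cmod ((a^*)%C * z) = 1 by rewrite -e cmod1.
rewrite cmodM cmod_conj -ltNge; have := cmod_ge0 a; have := cmod_ge0 z; nra.
Qed.

Lemma cmod_blaschke_factor_le1 a z : disk a -> cdisk z ->
  cmod (blaschke_factor a z) <= 1.
Proof.
move=> a1 z1; have d0 := blaschke_den_neq0 a1 z1.
rewrite /blaschke_factor cmodM cmodV ler_pdivrMr ?cmod_gt0 // mul1r.
rewrite -(@ler_pXn2r _ 2) ?nnegrE ?cmod_ge0 // -subr_ge0 blaschke_identity.
by rewrite mulr_ge0 // subr_ge0 exprn_ile1 ?cmod_ge0 // ltW.
Qed.

Lemma cmod_blaschke_factor_circle a z : disk a -> cmod z = 1 ->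
  cmod (blaschke_factor a z) = 1.
Proof.
move=> a1 z1; have d0 : 1 - (a^*)%C * z != 0.
  by apply: blaschke_den_neq0; rewrite // /closed_disk /= z1.
rewrite /blaschke_factor cmodM cmodV; apply/eqP.
rewrite -(inj_eq (mulIf (lt0r_neq0 _ : cmod (1 - (a^*)%C * z) != 0))) ?cmod_gt0 //.
rewrite divfK ?mul1r ?cmod_eq0 // -(@eqrXn2 _ 2) ?cmod_ge0 // eq_sym -subr_eq0.
by rewrite blaschke_identity z1 expr1n subrr mulr0.
Qed.

Lemma expandable_subr a b : expandable (fun z => z - a) b.
Proof. by apply: expandableD; [exact: expandable_id|exact: expandable_cst]. Qed.

Lemma expandable_blaschke_factor a b : disk a -> cdisk b ->
  expandable (blaschke_factor a) b.
Proof.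
move=> a1 b1; apply: expandableM; first exact: expandable_subr.
under [X in expandable X]eq_fun do rewrite -mulNr.
by apply: expandable_affine_inv; rewrite mulNr; exact: blaschke_den_neq0.
Qed.

Lemma blaschke_factor_order a b : disk a -> disk b ->
  has_order (blaschke_factor a) b (b == a).
Proof.
move=> a1 b1; have b1' : cdisk b by apply: ltW.
have [->|ba] := eqVneq b a; last first.
  apply: has_order0; first exact: expandable_blaschke_factor.
  by rewrite mulf_neq0 ?invr_eq0 ?blaschke_den_neq0 // subr_eq0.
have a1' : cdisk a by apply: ltW.
exists (fun z => (1 - (a^*)%C * z)^-1); split.
- under [X in expandable X]eq_fun do rewrite -mulNr.
  by apply: expandable_affine_inv; rewrite mulNr; exact: blaschke_den_neq0.
- by rewrite invr_eq0; exact: blaschke_den_neq0.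
- by apply: near_atW => z; rewrite expr1.
Qed.

(** The list may contain points of multiplicity 0, so one list can serve several Blaschke products,
    which are then compared factor by factor. *)
Definition covers m s := [/\ uniq s, (forall a, a \in s -> disk a) &
  forall a, disk a -> (0 < m a)%N -> a \in s].

Lemma blaschkeE m s : covers m s ->
  blaschke m = fun z => \prod_(a <- s) blaschke_factor a z ^+ m a.
Proof.
move=> [us sd ds]; apply/funext => z; rewrite [RHS]fsbig_seq //.
symmetry; apply: (@fsbig_widen _ _ _ _ [set` s] (@disk R)) => [a|a [Da ns]] /=.
  exact: sd.
have /negP := contra_not (ds a Da) ns.
by rewrite lt0n negbK => /eqP ->; rewrite expr0.
Qed.

Lemma blaschke_expandable m s : covers m s -> forall b, cdisk b ->
  expandable (blaschke m) b.
Proof.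
move=> ms b Db; rewrite (blaschkeE ms); have [us sd ds] := ms.
under [X in expandable X]eq_fun do rewrite big_seq.
apply: expandable_prod => a /sd Da; apply: expandableX.
exact: expandable_blaschke_factor.
Qed.

Lemma blaschke_order m s : covers m s -> forall b, disk b ->
  has_order (blaschke m) b (m b).
Proof.
move=> ms b Db; rewrite (blaschkeE ms); have [us sd ds] := ms.
have -> : m b = (\sum_(a <- s) (b == a) * m a)%N.
  have [bs|bs] := boolP (b \in s).
    rewrite (bigD1_seq b) //= eqxx mul1n big1_seq ?addn0 // => a /andP[ab _].
    by rewrite eq_sym (negbTE ab).
  rewrite big1_seq => [|a /andP[_ as_]].
    by apply/eqP; rewrite -leqn0 leqNgt; apply: contra bs; exact: ds.
  by case: eqP bs => // ->; rewrite as_.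
apply: has_order_prod => a /sd Da; apply: has_orderX.
exact: blaschke_factor_order.
Qed.

Lemma blaschke_le1 m s : covers m s -> forall z, cdisk z -> cmod (blaschke m z) <= 1.
Proof.
move=> ms z Dz; rewrite (blaschkeE ms) cmod_prod; have [us sd ds] := ms.
rewrite big_seq; apply: prodr_ile1 => a /sd Da; rewrite cmod_ge0 cmodX.
by rewrite exprn_ile1 ?cmod_ge0 // cmod_blaschke_factor_le1.
Qed.

Lemma blaschke_circle m s : covers m s -> forall z, cmod z = 1 ->
  cmod (blaschke m z) = 1.
Proof.
move=> ms z z1; rewrite (blaschkeE ms) cmod_prod; have [us sd ds] := ms.
rewrite big_seq; apply: big1 => a /sd Da.
by rewrite cmodX cmod_blaschke_factor_circle ?expr1n.
Qed.

(** Each factor has modulus at most 1, so the smaller exponent gives the larger modulus. *)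
Lemma blaschke_mul_le m1 m2 m3 n s : covers m1 s -> covers m2 s -> covers m3 s ->
  (forall a, disk a -> (m1 a <= m2 a + n * m3 a)%N) ->
  forall z, cdisk z ->
  cmod (blaschke m2 z) * cmod (blaschke m3 z) ^+ n <= cmod (blaschke m1 z).
Proof.
move=> c1 c2 c3 mm z Dz; have [us sd ds] := c1.
rewrite (blaschkeE c1) (blaschkeE c2) (blaschkeE c3) !cmod_prod -prodrXl -big_split /=.
rewrite [leLHS]big_seq [leRHS]big_seq; apply: ler_prod => a /sd Da.
rewrite !cmodX -exprM -exprD mulnC exprn_ge0 ?cmod_ge0 //=.
by apply: ler_wiXn2l; rewrite ?cmod_ge0 ?cmod_blaschke_factor_le1 ?mm.
Qed.

(* Division by the zeros: each factor [(z - a) ^+ m a] is removed in turn, the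
   quotient being analytic at [a] by definition of the order. *)
Lemma divide_zeros f m s : uniq s -> (forall a, a \in s -> has_order f a (m a)) ->
  (forall b, cdisk b -> expandable f b) ->
  (forall z, cdisk z -> f z = 0 -> z \in s) ->
  exists g, [/\ forall b, cdisk b -> expandable g b,
    forall z, cdisk z -> g z != 0 &
    forall z, f z = \prod_(a <- s) (z - a) ^+ m a * g z].
Proof.
elim: s f => [|a s IH] f /=.
  move=> _ _ fD f0; exists f; split => // z; last by rewrite big_nil mul1r.
  by move=> Dz; apply/negP => /eqP /(f0 _ Dz).
move=> /andP[as_ us] fm fD f0.
have [h [ha h0 fh]] := fm _ (mem_head _ _).
pose g z := if z == a then h a else f z / (z - a) ^+ m a.
have gh : near_at a (fun z => h z = g z).
  apply: near_atS fh => z fz; rewrite /g; case: eqP => [->//|/eqP za].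
  by rewrite fz mulrC mulKf // expf_neq0 // subr_eq0.
have ga : expandable g a by exact: expandable_near gh ha.
have fg z : f z = (z - a) ^+ m a * g z.
  rewrite /g; case: eqP => [->|/eqP za]; first exact: near_at_self fh.
  by rewrite mulrC divfK // expf_neq0 // subr_eq0.
(* Off [a] this is the inverse of [(z - a) ^+ m a], in the shape of [expandable_affine_inv]. There
   [g] is [f * q], hence analytic and with the orders of [f]. *)
pose q z := (((- a + 1 * z)^-1 : C) ^+ m a).
have gq b : b != a -> near_at b (fun z => f z * q z = g z).
  move=> ba; apply/near_cmodP; exists (cmod (b - a)); first by rewrite cmod_gt0 subr_eq0.
  move=> z zb; have za : z != a by apply: contraTneq zb => ->; rewrite cmodC ltxx.
  by rewrite fg /q mul1r (addrC (- a)) mulrAC exprVn divff ?mul1r // expf_neq0 // subr_eq0.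
have qe b : b != a -> expandable q b.
  move=> ba; apply: expandableX; apply: expandable_affine_inv.
  by rewrite mul1r addrC subr_eq0.
have gD b : cdisk b -> expandable g b.
  move=> Db; have [->//|ba] := eqVneq b a.
  by apply: expandable_near (gq b ba) _; apply: expandableM; [exact: fD|exact: qe].
have [|//|z Dz gz|k [kD k0 gk]] := IH g us.
- move=> b bs; have ba : b != a by apply: contraNneq as_ => <-.
  apply: has_order_near (gq b ba) _; rewrite -[m b]addn0; apply: has_orderM.
    by apply: fm; rewrite inE bs orbT.
  apply: has_order0; first exact: qe.
  by rewrite /q expf_neq0 // invr_eq0 mul1r addrC subr_eq0.
- have := f0 _ Dz; rewrite fg gz mulr0 => /(_ erefl); rewrite inE => /orP[/eqP za|//].
  by move: h0; rewrite (near_at_self gh) -za gz eqxx.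
exists k; split => // z; by rewrite fg gk big_cons mulrA.
Qed.

(** [F] is the zero-free quotient of [divide_zeros] times the denominators of the Blaschke factors.
    These have no zero in the closed disk, where the identity is asserted. *)
Lemma blaschke_factorization f s : covers (mult (f : (C : numFieldType) -> _)) s ->
  (forall b, cdisk b -> exists k, has_order f b k) ->
  (forall zeta : circle R, f (val zeta) != 0) ->
  exists F, [/\ forall b, cdisk b -> expandable F b,
    forall z, cdisk z -> F z != 0 &
    forall z, cdisk z -> f z = F z * blaschke (mult (f : (C : numFieldType) -> _)) z].
Proof.
move=> fs fm f1; have [us sd ds] := fs; set m := mult _ in fs ds *.
have mm b : cdisk b -> has_order f b (m b).
  by move=> /fm[k fk]; rewrite /m (mult_order fk).
have sd' a : a \in s -> cdisk a by move=> /sd /ltW.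
have [|||g [gD g0 fg]] := @divide_zeros f m s us.
- by move=> a /sd' /mm.
- by move=> b /mm /has_order_expandable.
- move=> z Dz fz; have Dz' : disk z.
    rewrite /disk /= lt_neqAle Dz andbT; apply/negP => z1.
    by have := f1 (exist _ z z1); rewrite /= fz eqxx.
  apply: ds => //; rewrite lt0n; apply: contraPneq fz => m0.
  have [h [_ h0 /near_at_self]] := mm _ Dz; rewrite m0 expr0 mul1r => ->.
  exact/eqP.
exists (fun z => g z * \prod_(a <- s) (1 + - (a^*)%C * z) ^+ m a); split.
- move=> b Db; apply: expandableM; first exact: gD.
  apply: expandable_prod => a _; apply: expandableX; apply: expandableD.
    exact: expandable_cst.
  by apply: expandableZ; exact: expandable_id.
- move=> z Dz; rewrite mulf_neq0 ?g0 // big_seq prodf_seq_neq0; apply/allP => a _.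
  by apply/implyP => /sd Da; rewrite expf_neq0 // mulNr blaschke_den_neq0.
move=> z Dz; rewrite (blaschkeE fs) fg mulrC -mulrA -big_split /=; congr (_ * _).
rewrite [LHS]big_seq [RHS]big_seq; apply: eq_bigr => a /sd Da.
by rewrite -exprMn mulNr mulrC divfK ?blaschke_den_neq0.
Qed.

End Blaschke.

(** * Wronskians *)

Section Wronskian.
Variable R : realType.
Local Notation C := R[i].
Local Notation D f := (derive1 (f : (C : numFieldType) -> (C : numFieldType))).
Local Notation Dn i f := (derive1n i (f : (C : numFieldType) -> (C : numFieldType))).
Local Notation cdisk := (@closed_disk R).
Implicit Types (f g h : C -> C) (z a b : C).

Lemma deriv_power_mul k g a : expandable g a -> exists2 h, expandable h a &
  near_at a (fun z => (D (fun z => (z - a) ^+ k * g z)) z = (z - a) ^+ k.-1 * h z).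
Proof.
move=> ga; elim: k => [|k [h ha IH]].
  exists (D g); first exact: expandable_deriv.
  by apply: near_atW => z; under eq_fun do rewrite expr0 mul1r; rewrite expr0 mul1r.
have ke : expandable (fun z => (z - a) ^+ k * g z) a.
  by apply: expandableM => //; apply: expandableX; exact: expandable_subr.
(* The product rule leaves [(z - a) * (z - a) ^+ k.-1 * h z]. For [k = 0] the predecessor does not
   lower the exponent, and the factor [z - a] stays in the cofactor. *)
exists (fun z => g z + (if k is 0%N then z - a else 1) * h z).
  apply: expandableD => //; apply: expandableM => //.
  by case: (k); [exact: expandable_subr|move=> _; exact: expandable_cst].
apply: near_atS2 (expandable_is_derive ke) IH => z kz hz.
under eq_fun do rewrite exprS -mulrA.
rewrite (derive1_mulX a kz) hz.
by case: (k) => [|j] /=; rewrite ?expr0 ?exprS; ring.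
Qed.

Lemma derive1n_power_mul f g a k : expandable g a ->
  near_at a (fun z => f z = (z - a) ^+ k * g z) ->
  forall i, exists2 h, expandable h a &
    near_at a (fun z => (Dn i f) z = (z - a) ^+ (k - i) * h z).
Proof.
move=> ga fg; elim=> [|i [h ha IH]]; first by exists g; rewrite // subn0.
have [h' ha' h'h] := deriv_power_mul (k - i) ha; exists h' => //.
apply: near_atS2 (near_at_near IH) h'h => z fz; rewrite subnS => <-.
by rewrite derive1nS; exact: near_derive1.
Qed.

Lemma derive1n_lincomb m (F : 'I_m -> C -> C) (u : 'I_m -> C) a :
  (forall j, expandable (F j) a) -> forall i,
  near_at a (fun z => (Dn i (fun z => \sum_j u j * F j z)) z = \sum_j u j * (Dn i (F j)) z).
Proof.
move=> Fa; elim=> [|i IH]; first exact: near_atW.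
have dF : near_at a (fun z => forall j, is_derive (z : (C : numFieldType)) 1
    (Dn i (F j)) ((D (Dn i (F j))) z)).
  by apply: near_at_all => j; apply: expandable_is_derive; exact: expandable_derive1n.
apply: near_atS2 (near_at_near IH) dF => z IHz dFz.
rewrite derive1nS (near_derive1 IHz).
under [RHS]eq_bigr do rewrite derive1nS.
exact: derive1_lincomb.
Qed.

Local Notation wr F := (wronskian (F : _ -> (C : numFieldType) -> (C : numFieldType))).

Lemma expandable_wronskian m (F : 'I_m -> C -> C) a :
  (forall j, expandable (F j) a) -> expandable (wr F) a.
Proof.
move=> Fa; apply: expandable_det => i j.
by under [X in expandable X]eq_fun do rewrite mxE; exact: expandable_derive1n.
Qed.

(* Cramer's rule: with [M] the Wronskian matrix, [M *m u] is the column of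
   derivatives of [G], so [det M = (adj M *m (M *m u)) j0]. *)
Lemma wronskian_divisible n (F : 'I_n.+1 -> C -> C) (u : 'I_n.+1 -> C) j0 G g k a :
  (forall j, expandable (F j) a) -> u j0 = 1 ->
  near_at a (fun z => \sum_j u j * F j z = G z) -> expandable g a ->
  near_at a (fun z => G z = (z - a) ^+ k * g z) ->
  exists2 h, expandable h a &
    near_at a (fun z => wr F z = (z - a) ^+ (k - n) * h z).
Proof.
move=> Fa u1 FG ga Gg.
pose M z : 'M[C]_n.+1 := \matrix_(i, j) (Dn i (F j)) z.
have Me i j : expandable (fun z => M z i j) a.
  by under [X in expandable X]eq_fun do rewrite mxE; exact: expandable_derive1n.
have ex (i : 'I_n.+1) : exists h, expandable h a /\
    near_at a (fun z => (Dn i G) z = (z - a) ^+ (k - n) * h z).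
  have [h ha hG] := derive1n_power_mul ga Gg i.
  (* Row [i] loses only [i <= n] powers; the surplus goes into the cofactor so that all rows share
     [(z - a) ^+ (k - n)]. *)
  exists (fun z => (z - a) ^+ (k - i - (k - n)) * h z); split.
    by apply: expandableM => //; apply: expandableX; exact: expandable_subr.
  apply: near_atS hG => z ->; rewrite mulrA -exprD subnKC // leq_sub2l //.
  by rewrite -ltnS.
have [h hP] := choice ex.
exists (fun z => \sum_i (\adj (M z)) j0 i * h i z).
  apply: expandable_sum => i _; apply: expandableM; last by case: (hP i).
  under [X in expandable X]eq_fun do rewrite mxE.
  apply: expandableZ; apply: expandable_det => i' j'.
  by under [X in expandable X]eq_fun do rewrite !mxE; exact: expandable_derive1n.
have hn : near_at a (fun z => forall i : 'I_n.+1, (Dn i G) z = (z - a) ^+ (k - n) * h i z).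
  by apply: near_at_all => i; case: (hP i).
have cn : near_at a (fun z => forall i : 'I_n.+1,
    (Dn i (fun z => \sum_j u j * F j z)) z = \sum_j u j * (Dn i (F j)) z).
  by apply: near_at_all => i; exact: derive1n_lincomb.
have gn : near_at a (fun z => forall i : 'I_n.+1,
    (Dn i (fun z => \sum_j u j * F j z)) z = (Dn i G) z).
  by apply: near_at_all => i; exact: near_derive1n.
have gcn : near_at a (fun z => forall i : 'I_n.+1, (Dn i G) z = \sum_j u j * (Dn i (F j)) z).
  by apply: near_atS2 cn gn => z c g' i; rewrite -g'.
apply: near_atS2 hn gcn => z hz gz.
have MU i : (M z *m \col_j u j) i ord0 = (z - a) ^+ (k - n) * h i z.
  rewrite -hz gz mxE; apply: eq_bigr => j _; rewrite !mxE; exact: mulrC.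
have := congr1 (fun A : 'cV_n.+1 => A j0 ord0) (mulmxA (\adj (M z)) (M z) (\col_j u j)).
rewrite mul_adj_mx mul_scalar_mx [RHS]mxE [X in _ = _ * X]mxE u1 mulr1 mxE => detE.
apply: (etrans (esym detE)).
by rewrite mulr_sumr; apply: eq_bigr => i _; rewrite MU mulrCA.
Qed.

(** If [G] vanished near [a], it would be divisible by the power [w + 1 + n] of [z - a], hence the
    Wronskian by the power [w + 1], beyond its order. So [G] has an order [k], and divisibility of
    the Wronskian by the power [k - n] bounds it. *)
Lemma order_combination n (F : 'I_n.+1 -> C -> C) (u : 'I_n.+1 -> C) j0 G w a :
  (forall j, expandable (F j) a) -> u j0 = 1 ->
  near_at a (fun z => \sum_j u j * F j z = G z) -> has_order (wr F) a w ->
  exists2 k, has_order G a k & (k <= w + n)%N.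
Proof.
move=> Fa u1 FG [h [ha h0 Wh]].
have Ga : expandable G a.
  apply: (expandable_near FG); apply: expandable_sum => j _.
  exact: expandableZ.
have [G0|[k Gk]] := expandable_order Ga.
  have [|h' ha' Wh'] := @wronskian_divisible _ F u j0 G (fun=> 0) (w.+1 + n) a
    Fa u1 FG (expandable_cst _ _).
    by apply: near_atS G0 => z ->; rewrite mulr0.
  by have := order_ge ha h0 ha' Wh Wh'; rewrite addnK ltnn.
exists k => //; have [g [ga g0 Gg]] := Gk.
have [h' ha' Wh'] := wronskian_divisible Fa u1 FG ga Gg.
by rewrite addnC -leq_subLR; exact: order_ge ha h0 ha' Wh Wh'.
Qed.

Lemma exists_inner (zeta : C) (e : R) : cmod zeta = 1 -> 0 < e ->
  exists2 b, disk b & cmod (b - zeta) < e.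
Proof.
move=> z1 e0; set t := Num.min e 1 / 2.
have m0 : 0 < Num.min e 1 by rewrite lt_min e0 ltr01.
have t0 : 0 < t by rewrite divr_gt0.
have : t < Num.min e 1 by rewrite /t; lra.
rewrite lt_min => /andP[te t1].
exists (((1 - t)%:C)%C * zeta).
  by rewrite /disk /= cmodM z1 mulr1 cmod_real gtr0_norm; lra.
have -> : ((1 - t)%:C)%C * zeta - zeta = - ((t%:C)%C * zeta).
  by rewrite rmorphB rmorph1; ring.
by rewrite cmodN cmodM z1 mulr1 cmod_real gtr0_norm.
Qed.

Lemma near_disk b : disk b -> near_at b cdisk.
Proof.
move=> b1; apply/near_cmodP; exists (1 - cmod b); first by rewrite subr_gt0.
move=> z zb; rewrite /closed_disk /=; have -> : z = (z - b) + b by ring.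
by apply: (le_trans (cmodD _ _)); lra.
Qed.

(** * Orders of the members of a family whose last function is the sum of the others *)

Section Family.
Variables (n : nat) (f : 'I_n.+2 -> C -> C).
Local Notation F := (fun j : 'I_n.+1 => f (widen_ord (leqnSn n.+1) j)).
Hypothesis fD : forall j a, cdisk a -> expandable (f j) a.
Hypothesis fsum : forall z, cdisk z -> f ord_max z = \sum_(j < n.+1) F j z.
Hypothesis W1 : forall zeta : circle R, wr F (val zeta) != 0.

Lemma wronskian_order a : cdisk a -> exists w, has_order (wr F) a w.
Proof.
apply: order_on_disk => // b Db; apply: expandable_wronskian => j; exact: fD.
Qed.

(** The first [n + 1] functions are combinations with Kronecker coefficients, the last has all
    coefficients 1. The sum relation is given on the closed disk only; at an interior [a] it holds
    on a whole neighbourhood. *)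
Lemma family_order j a w : disk a -> has_order (wr F) a w ->
  exists2 k, has_order (f j) a k & (k <= w + n)%N.
Proof.
move=> a1 Ww; have Da : cdisk a by apply: ltW.
have FD i : expandable (F i) a by exact: fD.
have [i ->|->] := @unliftP n.+2 ord_max j.
  have -> : lift ord_max i = widen_ord (leqnSn n.+1) i.
    by apply: val_inj; rewrite /= /bump leqNgt ltn_ord add0n.
  apply: (@order_combination n F (fun l => (l == i)%:R) i) => //.
    by rewrite eqxx.
  apply: near_atW => z; rewrite (bigD1 i) //= eqxx mul1r big1 ?addr0 // => l /negbTE ->.
  by rewrite mul0r.
apply: (@order_combination n F (fun=> 1) ord0) => //.
apply: near_atS (near_disk a1) => z /fsum ->.
by apply: eq_bigr => l _; rewrite mul1r.
Qed.

(** At a point of the circle the sum relation covers only part of a neighbourhood. But a member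
    vanishing near such a point vanishes near interior points as well, where [family_order] forbids
    it. *)
Lemma family_order_closed j a : cdisk a -> exists k, has_order (f j) a k.
Proof.
move=> Da; have [f0|//] := expandable_order (fD j Da); exfalso.
have [e e0 he] : exists2 e : R, 0 < e &
    forall z, cmod (z - a) < e -> near_at z (fun x => f j x = 0).
  by apply/near_cmodP; exact: near_at_near f0.
have [b b1 ba] : exists2 b, disk b & cmod (b - a) < e.
  have [a1|a1] := eqVneq (cmod a) 1; first exact: exists_inner.
  by exists a; [rewrite /disk /= lt_neqAle a1|rewrite subrr cmod0].
have [w Ww] := wronskian_order (ltW b1 : cdisk b).
have [k fk _] := family_order j b1 Ww.
exact: has_order_not_near0 fk (he _ ba).
Qed.

End Family.
End Wronskian.

(** * The circle *)

Section Circle.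
Variable R : realType.
Local Notation C := R[i].
Local Notation cdisk := (@closed_disk R).
Local Notation arcR := (Defs.arc R).
Implicit Types (f g h : C -> C) (z a b : C) (t : R).

Lemma expi_continuous t0 (e : R) : 0 < e -> exists2 d : R, 0 < d &
  forall t, `|t - t0| < d -> cmod (val (expi t) - val (expi t0)) < e.
Proof.
move=> e0; have e2 : 0 < e / 2 by rewrite divr_gt0.
have /cvgrPdist_lt/(_ _ e2)/nbhs_normP[d1 /= d10 h1] := @continuous_cos R t0.
have /cvgrPdist_lt/(_ _ e2)/nbhs_normP[d2 /= d20 h2] := @continuous_sin R t0.
exists (Num.min d1 d2); first by rewrite lt_min d10.
move=> t; rewrite lt_min distrC => /andP[/h1 t1 /h2 t2].
apply: (le_lt_trans (cmod_le_ReIm (val (expi t) - val (expi t0)))).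
by move: t1 t2; rewrite /= distrC => t1; rewrite distrC => t2; lra.
Qed.

Lemma expi_onto (zeta : circle R) : exists2 t, 0 <= t <= 2 * pi & expi t = zeta.
Proof.
case: zeta => -[x y] z1; have xy : x ^+ 2 + y ^+ 2 = 1.
  by have := sqr_cmod (x +i* y)%C; rewrite (eqP z1) expr1n => ->.
have x1 : -1 <= x <= 1.
  by have := sqr_ge0 y => y2; apply/andP; split; nra.
have x1' : x \in `[(-1), 1] by rewrite in_itv.
have pi0 := @pi_ge0 R.
have [y0|y0] := leP 0 y.
  exists (acos x).
    by rewrite acos_ge0 //= (le_trans (acos_lepi x1)) //; lra.
  apply: val_inj; rewrite /= acosK // sin_acos //; congr (_ +i* _)%C.
  have -> : 1 - x ^+ 2 = y ^+ 2 by lra.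
  by rewrite sqrtr_sqr ger0_norm.
exists (pi *+ 2 - acos x).
  rewrite subr_ge0 mulr2n; have := acos_ge0 x1; have := acos_lepi x1.
  by move=> h1 h2; apply/andP; split; lra.
apply: val_inj; rewrite /= cosB sinB cos2pi sin2pi acosK // sin_acos //.
rewrite mul1r mul0r addr0 mul0r mul1r sub0r; congr (_ +i* _)%C.
have -> : 1 - x ^+ 2 = y ^+ 2 by lra.
by rewrite sqrtr_sqr ltr0_norm ?opprK.
Qed.

Lemma arc_itv_gt0 (u v : R) : 0 <= u -> v <= 2 * pi -> u < v ->
  (0 < arcR `[u, v]%classic)%E.
Proof.
move=> u0 v2 uv; rewrite /Defs.arc /= /uniform_prob integral_uniform_pdf.
have -> : `[u, v]%classic `&` `[0, 2 * pi]%classic = `[u, v]%classic :> set R.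
  apply/seteqP; split=> [x []//|x xuv]; split => //; move: xuv.
  rewrite /= !in_itv /= => /andP[h1 h2].
  by rewrite (le_trans u0 h1) (le_trans h2 v2).
rewrite (eq_integral (cst ((2 * pi)^-1)%:E)); last first.
  move=> x; rewrite inE /= in_itv /= => /andP[h1 h2]; rewrite /uniform_pdf subr0.
  by rewrite (le_trans u0 h1) (le_trans h2 v2).
rewrite integral_cst //= lebesgue_measure_itv /= lte_fin uv -EFinD -EFinM lte_fin.
by rewrite mulr_gt0 ?subr_gt0 // invr_gt0 mulr_gt0 // pi_gt0.
Qed.

(** An interval around [t0], cut to [[0, 2 * pi]], has positive arc measure and does not fit into a
    null set. *)
Lemma ae_arc_meets (P : R -> Prop) t0 d : {ae arcR, forall t, P t} ->
  0 <= t0 <= 2 * pi -> 0 < d -> exists2 t, `|t - t0| < d & P t.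
Proof.
move=> [A [mA A0 PA]] /andP[t00 t01] d0; apply: contrapT => nP.
have pi0 := @pi_gt0 R.
pose u := Num.max 0 (t0 - d / 2); pose v := Num.min (2 * pi) (t0 + d / 2).
have uv : u < v.
  by rewrite /u /v lt_min !gt_max; apply/andP; split; apply/andP; split; lra.
have uA : `[u, v]%classic `<=` A.
  move=> t; rewrite /= in_itv /= /u /v ge_max le_min => /andP[/andP[_ h1] /andP[_ h2]].
  apply: PA => /= Pt; apply: nP; exists t => //.
  by rewrite ltr_norml; apply/andP; split; lra.
have := @arc_itv_gt0 u v; rewrite /u /v le_max lexx ge_min lexx => /(_ isT isT uv).
apply/negP; rewrite -leNgt -A0; apply: le_measure => //; rewrite inE //.
Qed.

(** The essential supremum bounds almost every value; continuity at [zeta] and the density of sets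
    of full measure carry the bound to [zeta] itself, up to an arbitrary [e]. *)
Lemma le_supnorm h (zeta : circle R) : continuousC_at h (val zeta) ->
  ((cmod (h (val zeta)))%:E <= supnorm h)%E.
Proof.
move=> hc; have [t0 t01 ez] := expi_onto zeta.
(* The norm of exponent [+oo] is an essential supremum when the total mass is positive; here it is
   1. *)
rewrite /supnorm unlock /= ifT; last first.
  by have -> : arcR [set: R] = 1%E by exact: probability_setT.
set f := abse \o _; have fae := @ess_sup_ge _ _ _ arcR f.
apply/lee_addgt0Pr => e e0.
have [d1 d10 hd1] := hc _ e0.
have [d d0 hd] := expi_continuous t0 d10.
have [t td ft] := ae_arc_meets fae t01 d0.
apply: (@le_trans _ _ (f t + e%:E)%E); last by rewrite leeD2r.
rewrite /f /= lee_fin ger0_norm ?cmod_ge0 //.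
have := hd _ td; rewrite ez => /hd1 hh.
have : cmod (h (val zeta)) <= cmod (h (val (expi t))) + cmod (h (val (expi t)) - h (val zeta)).
  by have {1}-> : h (val zeta) = h (val (expi t)) - (h (val (expi t)) - h (val zeta))
    by [ring]; exact: cmodB.
by rewrite /=; lra.
Qed.

Lemma hardy_closed_disk f p : 0 <= p -> (forall a, cdisk a -> expandable f a) -> hardy p f.
Proof.
move=> p0 fD; split; first by move=> z z1; apply/analytic_atP; apply: fD; exact: ltW.
have [M hM] := disk_bounded fD.
pose c : \bar R := (M `^ p)%:E.
apply: (@le_lt_trans _ _ c); last by rewrite ltry.
apply: ge_ereal_sup => y /= [r]; rewrite in_itv /= => /andP[r0 r1] <-.
have rD t : cdisk ((r%:C)%C * val (expi t)).
  by rewrite /closed_disk /mkset cmodM (eqP (valP (expi t))) mulr1 cmod_real ger0_norm // ltW.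
have mg : measurable_fun [set: R] (fun t => cmod (f ((r%:C)%C * val (expi t)))).
  apply: continuous_measurable_fun => t0; apply/cvgrPdist_lt => e e0.
  have [d1 d10 hd1] := expandable_continuous (fD _ (rD t0)) e0.
  have [d d0 hd] := expi_continuous t0 d10.
  apply/nbhs_normP; exists d => // t; rewrite /ball_ /= distrC => /hd td.
  set X := f _; set Y := f _.
  have XY : cmod (Y - X) < e.
    apply: hd1; rewrite -mulrBr cmodM cmod_real ger0_norm //.
    by apply: le_lt_trans td; rewrite ler_piMl ?cmod_ge0 // ltW.
  have h1 : cmod X <= cmod Y + cmod (Y - X).
    by have {1}-> : X = Y - (Y - X) by [ring]; exact: cmodB.
  have h2 : cmod Y <= cmod X + cmod (Y - X).
    by have {1}-> : Y = X + (Y - X) by [ring]; exact: cmodD.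
  by rewrite ltr_norml; apply/andP; split; lra.
apply: (@le_trans _ _ (\int[arcR]_t (cst c t))%E).
  apply: ge0_le_integral => //.
  - by move=> t _; rewrite lee_fin powR_ge0.
  - by apply/measurable_EFinP; exact: (measurableT_comp (@measurable_powR R p) mg).
  - move=> t _; rewrite lee_fin; have ht := hM _ (rD t).
    apply: ge0_ler_powR => //; rewrite nnegrE; first exact: cmod_ge0.
    by apply: le_trans ht; exact: cmod_ge0.
have aT : arcR [set: R] = 1%E by exact: probability_setT.
have ci := @integral_cst _ _ R arcR _ measurableT c.
by rewrite ci [X in (_ * X)%E]aT mule1.
Qed.

Lemma boundary_modulusE f : (forall a, cdisk a -> expandable f a) ->
  boundary_modulus f = fun zeta : circle R => cmod (f (val zeta)).
Proof.
move=> fD; apply/funext => zeta; rewrite /boundary_modulus boundary_value_continuous //.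
by apply: expandable_continuous; apply: fD; rewrite /closed_disk /= (eqP (valP zeta)).
Qed.

End Circle.

(** * Inequalities for real powers *)

Section RealPowers.
Variable R : realType.
Implicit Types (p x y b u v : R).

(** After division by [u + v] both parts lie in [[0, 1]], where raising to the power [p >= 1] does
    not increase; the two bounds add up to [(u + v) ^ p]. *)
Lemma powR_superadditive p u v : 1 <= p -> 0 <= u -> 0 <= v ->
  u `^ p + v `^ p <= (u + v) `^ p.
Proof.
move=> p1 u0 v0; have p0 : p != 0 by rewrite gt_eqF // (lt_le_trans ltr01).
have [s0|s0] := eqVneq (u + v) 0.
  have -> : u = 0 by lra.
  have -> : v = 0 by lra.
  by rewrite addr0 powR0 // addr0.
have sgt : 0 < u + v by rewrite lt_neqAle eq_sym s0 addr_ge0.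
have part w : 0 <= w -> w <= u + v -> w `^ p <= (u + v) `^ p * (w / (u + v)).
  move=> w0 ws; have -> : w `^ p = (u + v) `^ p * (w / (u + v)) `^ p.
    by rewrite -powRM ?divr_ge0 ?(ltW sgt) // mulrC divfK.
  rewrite ler_wpM2l ?powR_ge0 //.
  have [->|w1] := eqVneq w 0; first by rewrite mul0r powR0.
  have wgt : 0 < w by rewrite lt_neqAle eq_sym w1.
  by apply: ge1r_powR => //; rewrite divr_gt0 //= ler_pdivrMr // mul1r.
apply: (le_trans (lerD (part u _ _) (part v _ _))) => //; rewrite ?lerDl ?lerDr //.
by rewrite -mulrDr -mulrDl divff // mulr1.
Qed.

(** Superadditivity applied to the [p]-th roots of [u] and [v]. *)
Lemma powR_inv_subadditive p u v : 1 <= p -> 0 <= u -> 0 <= v ->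
  (u + v) `^ p^-1 <= u `^ p^-1 + v `^ p^-1.
Proof.
move=> p1 u0 v0; have p0 : 0 < p by rewrite (lt_le_trans ltr01).
have pK w : 0 <= w -> (w `^ p^-1) `^ p = w.
  by move=> w0; rewrite -powRrM mulVf ?gt_eqF // powRr1.
have := @powR_superadditive p _ _ p1 (powR_ge0 u p^-1) (powR_ge0 v p^-1).
rewrite !pK // => h.
have := @ge0_ler_powR R p^-1 _ (u + v) _ _ _ h; rewrite -powRrM mulfV ?gt_eqF // powRr1.
  by apply; rewrite ?invr_ge0 ?(ltW p0) ?nnegrE ?addr_ge0 ?powR_ge0.
by rewrite addr_ge0 ?powR_ge0.
Qed.

Lemma one_sub_exp n x : 0 <= x <= 1 -> 1 - x ^+ n <= n%:R * (1 - x).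
Proof.
move=> /andP[x0 x1]; elim: n => [|n IH]; first by rewrite expr0 subrr mul0r.
have xn : x ^+ n <= 1 by rewrite exprn_ile1.
have xn0 : 0 <= x ^+ n by rewrite exprn_ge0.
by rewrite exprS -natr1; nra.
Qed.

(** Here [x], [y], [b] stand for the moduli of [BL], [J], [BR] at a point. With [Y = y ^ p] and
    [Q = b ^ (n p)], [1 - Y Q = (1 - Y) + Y (1 - Q) <= (1 - Y) + (1 - Q)], and
    [1 - Q <= n (1 - b ^ p)]. The [p]-th root of this [n] is the [n ^ (1 / p)] of the theorem. *)
Lemma blaschke_power_estimate p n x y b : 1 <= p ->
  0 <= x <= 1 -> 0 <= y <= 1 -> 0 <= b <= 1 -> y * b ^+ n <= x ->
  (1 - x `^ p) `^ p^-1 <=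
  (1 - y `^ p) `^ p^-1 + n%:R `^ p^-1 * (1 - b `^ p) `^ p^-1.
Proof.
move=> p1 /andP[x0 x1] /andP[y0 y1] /andP[b0 b1] ybx.
have p0 : 0 < p by rewrite (lt_le_trans ltr01).
have pw w : 0 <= w -> w <= 1 -> 0 <= w `^ p <= 1.
  move=> w0 w1; rewrite powR_ge0 /= -[leRHS]/((fun=> 1 : R) p) -powR1.
  by apply: ge0_ler_powR; rewrite ?nnegrE ?(ltW p0).
have /andP[xp0 xp1] := pw _ x0 x1; have /andP[yp0 yp1] := pw _ y0 y1.
have /andP[bp0 bp1] := pw _ b0 b1.
rewrite -powRM ?subr_ge0 //.
apply: (@le_trans _ _ ((1 - y `^ p + n%:R * (1 - b `^ p)) `^ p^-1)); last first.
  by apply: powR_inv_subadditive; rewrite ?subr_ge0 // mulr_ge0 ?subr_ge0.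
have bn0 : 0 <= b ^+ n by rewrite exprn_ge0.
have bnp : (b ^+ n) `^ p = (b `^ p) ^+ n.
  by rewrite -powR_mulrn // -powRrM mulrC powRrM powR_mulrn // powR_ge0.
have h : y `^ p * (b `^ p) ^+ n <= x `^ p.
  by rewrite -bnp -powRM //; apply: ge0_ler_powR; rewrite ?nnegrE ?mulr_ge0 ?(ltW p0).
have h2 := @one_sub_exp n (b `^ p); rewrite bp0 bp1 in h2.
have {}h2 := h2 isT.
have q1 : (b `^ p) ^+ n <= 1 by rewrite exprn_ile1.
have q0 : 0 <= (b `^ p) ^+ n by rewrite exprn_ge0.
apply: ge0_ler_powR; rewrite ?invr_ge0 ?(ltW p0) ?nnegrE ?subr_ge0 //.
  by rewrite addr_ge0 ?subr_ge0 // mulr_ge0 ?subr_ge0.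
nra.
Qed.

End RealPowers.

(** * The Garsia-type norm *)

Lemma continuousC_inv (R : realType) (f : R[i] -> R[i]) a :
  continuousC_at f a -> f a != 0 -> continuousC_at (fun z => (f z)^-1) a.
Proof.
move=> fc fa e e0; have ca : 0 < cmod (f a) by rewrite cmod_gt0.
have d10 : 0 < e * cmod (f a) ^+ 2 / 2 by rewrite divr_gt0 ?mulr_gt0 ?exprn_gt0.
have [d1 d1p h1] := fc _ d10.
have /near_cmodP[d2 d2p h2] : near_at a (fun z => cmod (f a) / 2 < cmod (f z)).
  by apply: near_cmod_gt => //; lra.
exists (Num.min d1 d2) => [|z]; first by rewrite lt_min d1p.
rewrite lt_min => /andP[/h1 z1 /h2 z2].
have cz : 0 < cmod (f z) by lra.
have fz : f z != 0 by rewrite -cmod_gt0.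
have -> : (f z)^-1 - (f a)^-1 = (f a - f z) / (f z * f a) by field; rewrite fa.
rewrite cmodM cmodV cmodM cmodC ltr_pdivrMr ?mulr_gt0 //; apply: (lt_le_trans z1).
have -> : e * cmod (f a) ^+ 2 / 2 = e * (cmod (f a) / 2 * cmod (f a)) by ring.
by rewrite ler_wpM2l ?(ltW e0) // ler_wpM2r ?(ltW ca) // ltW.
Qed.

Section GarsiaEstimate.
Variables (R : realType) (p : R) (Psi : (circle R -> R) -> R[i] -> \bar R) (k : R[i] -> R).
Local Notation C := R[i].
Local Notation cdisk := (@closed_disk R).
Local Notation N := (garsia_norm p Psi k).
Hypothesis p1 : 1 <= p.
Hypothesis k0 : forall z, disk z -> 0 < k z.
Implicit Types (f : C -> C) (z : C).

Definition garsia_term f z : \bar R :=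
  ((Psi (boundary_modulus f) z - (cmod (f z) `^ p)%:E) `^ p^-1 * (k z)^-1%:E)%E.

Lemma garsia_term_ge0 f z : disk z -> (0 <= garsia_term f z)%E.
Proof. by move=> /k0 kz; rewrite mule_ge0 ?poweR_ge0 // lee_fin invr_ge0 ltW. Qed.

Lemma garsia_term_le f z : disk z -> (garsia_term f z <= N f)%E.
Proof. by move=> Dz; apply: ereal_sup_ubound; exists z. Qed.

Lemma garsia_norm_ge0 f : (0 <= N f)%E.
Proof.
have D0 : disk (0 : C) by rewrite /disk /mkset cmod0.
exact: le_trans (garsia_term_ge0 f D0) (garsia_term_le f D0).
Qed.

(** The boundary modulus is the constant 1, so the normalization of [Psi] evaluates the term. *)
Lemma garsia_term_inner f z : (forall z, disk z -> Psi (fun=> 1) z = 1%:E) ->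
  (forall a, cdisk a -> expandable f a) -> (forall z, cmod z = 1 -> cmod (f z) = 1) ->
  disk z -> garsia_term f z = ((1 - cmod (f z) `^ p) `^ p^-1 / k z)%:E.
Proof.
move=> Psi1 fD f1 Dz; rewrite /garsia_term boundary_modulusE //.
have -> : (fun zeta : circle R => cmod (f (val zeta))) = fun=> 1.
  by apply/funext => -[w w1] /=; rewrite f1 // (eqP w1).
by rewrite Psi1 // -EFinB poweR_EFin -EFinM.
Qed.

(* [J] is an inner factor of [W = F * J], so that [Psi |W| = Psi |F| >= |F z| ^ p]
   and the defect [1 - |J z| ^ p] is at most [|F z| ^ - p * (Psi |W| - |W z| ^ p)]. *)
Lemma garsia_term_factor W F J (S : \bar R) z :
  (forall f z, hardy p f -> disk z -> ((cmod (f z) `^ p)%:E <= Psi (boundary_modulus f) z)%E) ->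
  (forall a, cdisk a -> expandable W a) -> (forall a, cdisk a -> expandable F a) ->
  (forall z, cmod z = 1 -> cmod (J z) = 1) -> (forall z, cdisk z -> cmod (J z) <= 1) ->
  (forall z, cdisk z -> W z = F z * J z) ->
  disk z -> F z != 0 -> ((cmod (F z))^-1%:E <= S)%E ->
  (((1 - cmod (J z) `^ p) `^ p^-1 / k z)%:E <= garsia_term W z * S)%E.
Proof.
move=> PsiF WD FD J1 Jle WFJ Dz F0 FS; have p0 : 0 < p by rewrite (lt_le_trans ltr01).
have Dz' : cdisk z by exact: ltW.
have cF : 0 < cmod (F z) by rewrite cmod_gt0.
have bm : boundary_modulus W = boundary_modulus F.
  rewrite !boundary_modulusE //; apply/funext => -[w w1] /=.
  by rewrite WFJ ?cmodM ?J1 ?mulr1 ?(eqP w1) // /closed_disk /mkset (eqP w1).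
have PF : ((cmod (F z) `^ p)%:E <= Psi (boundary_modulus W) z)%E.
  by rewrite bm; apply: PsiF => //; apply: hardy_closed_disk => //; exact: ltW.
have Jp : cmod (J z) `^ p <= 1.
  rewrite -[leRHS]/((fun=> 1 : R) p) -powR1.
  by apply: ge0_ler_powR; rewrite ?nnegrE ?cmod_ge0 ?(ltW p0) // Jle.
have Wp : cmod (W z) `^ p = cmod (F z) `^ p * cmod (J z) `^ p.
  by rewrite WFJ // cmodM powRM ?cmod_ge0.
have d0 : 0 <= cmod (F z) `^ p - cmod (W z) `^ p.
  by rewrite subr_ge0 Wp ler_piMr // powR_ge0.
(* The [p]-th root of [|F| ^ p * (1 - |J| ^ p)] releases a factor [|F|], cancelled by [1 / |F|]. *)
have -> : ((1 - cmod (J z) `^ p) `^ p^-1 / k z)%:E =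
    (((cmod (F z) `^ p - cmod (W z) `^ p) `^ p^-1 / k z)%:E * (cmod (F z))^-1%:E)%E.
  rewrite -EFinM; congr (_%:E).
  have -> : cmod (F z) `^ p - cmod (W z) `^ p = cmod (F z) `^ p * (1 - cmod (J z) `^ p).
    by rewrite Wp; ring.
  rewrite powRM ?subr_ge0 ?powR_ge0 // -powRrM mulfV ?gt_eqF // powRr1 ?cmod_ge0 //.
  by field; rewrite !gt_eqF //; exact: k0.
apply: lee_pmul => //.
- by rewrite lee_fin divr_ge0 ?powR_ge0 // ltW // k0.
- by rewrite lee_fin invr_ge0 cmod_ge0.
rewrite EFinM; apply: lee_wpmul2r; first by rewrite lee_fin invr_ge0 ltW // k0.
rewrite -(poweR_EFin (cmod (F z) `^ p - cmod (W z) `^ p)); apply: gt0_ler_poweR.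
- by rewrite invr_ge0 ltW.
- by rewrite in_itv /= lee_fin d0 leey.
- have h : (0 <= Psi (boundary_modulus W) z - (cmod (W z) `^ p)%:E)%E.
    by rewrite sube_ge0 //; apply: le_trans PF; rewrite lee_fin -subr_ge0.
  by rewrite in_itv /= leey andbT.
by rewrite EFinB leeB.
Qed.

End GarsiaEstimate.

(** * Comparison of the multiplicities of the Wronskian, the least common multiple and the
    radical *)

Section Configuration.
Variables (R : realType) (n : nat) (f : 'I_n.+2 -> R[i] -> R[i]).
Local Notation C := R[i].
Local Notation cdisk := (@closed_disk R).
Hypothesis fD : forall j, analytic_on cdisk (f j : (C : numFieldType) -> (C : numFieldType)).
Hypothesis fsum : forall z, cdisk z ->
  f ord_max z = \sum_(j < n.+1) f (widen_ord (leqnSn n.+1) j) z.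
Let W := wronskian (fun j : 'I_n.+1 => f (widen_ord (leqnSn n.+1) j)).
Hypothesis W1 : forall zeta : circle R, W (val zeta) != 0.
Let B := fun j => blaschke_of (f j).
Let BL := blaschke_lcm B.
Let BR := blaschke_rad (fun z => \prod_(j < n.+2) B j z).

Let fE j a : cdisk a -> expandable (f j) a.
Proof. by move=> Da; apply/analytic_atP; exact: fD. Qed.

Let WE a : cdisk a -> expandable W a.
Proof. by move=> Da; apply: expandable_wronskian => j; exact: fE. Qed.

(** The list collects the zeros in the open disk of [W] and of all [f j], so that it covers the
    three products at once. Multiplicities of [B j] and [f j] agree in the open disk, which reduces
    the final inequality to [family_order]. *)
Lemma blaschke_configuration : exists s, [/\
  covers (mult W) s,
  covers (fun a => \max_(i : 'I_n.+2) mult (B i) a)%N s,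
  covers (fun a => (0 < mult (fun z => (\prod_(j < n.+2) B j z)%R) a)%N : nat) s &
  forall a, disk a -> (\max_(i : 'I_n.+2) mult (B i) a <=
    mult W a + n * (0 < mult (fun z => (\prod_(j < n.+2) B j z)%R) a))%N].
Proof.
have [sW hW] := finite_zeros (wronskian_order fE W1).
have [sf hf] := choice (fun j => finite_zeros (@family_order_closed _ _ _ fE fsum W1 j)).
pose s := undup [seq a <- sW ++ flatten [seq sf j | j <- enum 'I_n.+2] | cmod a < 1].
have us : uniq s by exact: undup_uniq.
have sd a : a \in s -> disk a by rewrite mem_undup mem_filter => /andP[].
have sW' a : disk a -> (0 < mult W a)%N -> a \in s.
  move=> Da /mult_gt0_root Wa; rewrite mem_undup mem_filter Da mem_cat hW //.
  exact: ltW.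
have sf' j a : disk a -> (0 < mult (f j) a)%N -> a \in s.
  move=> Da /mult_gt0_root fa; rewrite mem_undup mem_filter Da mem_cat /=.
  apply/orP; right; apply/flattenP; exists (sf j).
    by apply/mapP; exists j; rewrite ?mem_enum.
  by apply: hf => //; exact: ltW.
have cf j : covers (mult (f j)) s by split => //; exact: sf'.
have Bo j a : disk a -> has_order (B j) a (mult (f j) a).
  by move=> Da; exact: blaschke_order (cf j) a Da.
have Bm j a : disk a -> mult (B j) a = mult (f j) a.
  by move=> Da; exact: mult_order (Bo j a Da).
have Pm a : disk a -> mult (fun z => \prod_(j < n.+2) B j z) a =
    (\sum_(j < n.+2) mult (f j) a)%N.
  by move=> Da; apply: mult_order; apply: has_order_prod => j _; exact: Bo.
exists s; split => //.
- split=> // a Da; rewrite lt0n; apply: contraR => as_.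
  rewrite -leqn0; apply/bigmax_leqP => j _; rewrite Bm // leqNgt.
  by apply: contra as_; exact: sf'.
- split=> // a Da; rewrite Pm // lt0b lt0n; apply: contraR => as_; rewrite sum_nat_eq0; apply/forallP => j.
  apply/implyP => _; rewrite -leqn0 leqNgt.
  by apply: contra as_; exact: sf'.
move=> a Da; apply/bigmax_leqP => j _; rewrite Bm //.
have [w Ww] := wronskian_order fE W1 (ltW Da : cdisk a).
have [l fl lw] := family_order fE fsum j Da Ww.
rewrite Pm // (mult_order Ww) (mult_order fl).
(* Where no member of the family vanishes, [l] itself is 0; elsewhere the radical contributes the
   full [n]. *)
case: posnP => [/eqP|_]; last by rewrite muln1.
rewrite sum_nat_eq0 => /forallP/(_ j); rewrite (mult_order fl) => /eqP ->.
by [].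
Qed.

End Configuration.

Theorem theorem3p1 (R : realType) (X : analytic_space R) (p : R)
    (Psi : (circle R -> R) -> R[i] -> \bar R) (k : R[i] -> R)
    (hN : is_garsia_norm p Psi k X) (hp : 1 <= p)
    (hPsi1 : forall z, disk z -> Psi (fun=> 1) z = 1%:E) :
  exists2 c : R, 0 < c &
    forall (n : nat) (f : 'I_n.+2 -> R[i] -> R[i]),
      (1 <= n)%N ->
      (forall j, analytic_on (@closed_disk R) (f j)) ->
      (forall z, closed_disk z ->
         f ord_max z = \sum_(j < n.+1) f (widen_ord (leqnSn n.+1) j) z) ->
      let W := wronskian (fun j : 'I_n.+1 => f (widen_ord (leqnSn n.+1) j)) in
      (forall zeta : circle R, W (val zeta) != 0) ->
      let invW := fun z => (W z)^-1 in
      let B := fun j => blaschke_of (f j) in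
      let BL := blaschke_lcm B in
      let BR := blaschke_rad (fun z => \prod_(j < n.+2) B j z) in
      let N := garsia_norm p Psi k in
      let normX := space_enorm X in
      let gamma := (N W * supnorm invW)%E in
      let mu := (supnorm W * supnorm invW)%E in
      let kappa := (normX W * supnorm invW)%E in
      (N BL <= gamma + mu * (n%:R `^ p^-1)%:E * N BR)%E /\
      (c%:E * normX BL <= kappa + mu * (n%:R `^ p^-1)%:E * normX BR)%E.
Proof.
have [C1 [C2 [C10 C20 hC]]] := garsia_equiv hN.
have p0 : 0 <= p by rewrite (le_trans ler01).
(* [C2] pays for passing from the norm of [X] to [N] on the left, [C1] for passing back on the
   right; the same [C1] serves both terms there. *)
exists (C1 * C2)^-1; first by rewrite invr_gt0 mulr_gt0.
move=> n f _ fD fsum W W1 invW B BL BR N normX gamma mu kappa.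
have fE j a : closed_disk a -> expandable (f j) a.
  by move=> Da; apply/analytic_atP; exact: fD.
have WE a : closed_disk a -> expandable W a.
  by move=> Da; apply: expandable_wronskian => j; exact: fE.
have [s [cW cL cR mle]] := blaschke_configuration fD fsum W1.
have [F [FE F0 WF]] := blaschke_factorization cW (wronskian_order fE W1) W1.
set J := blaschke (mult W) in WF.
have BLE := blaschke_expandable cL; have BRE := blaschke_expandable cR.
have kz := garsia_k_gt0 hN.
have circleD (zeta : circle R) : closed_disk (val zeta).
  by rewrite /closed_disk /mkset (eqP (valP zeta)).
have invW_le (zeta : circle R) : ((cmod (W (val zeta)))^-1%:E <= supnorm invW)%E.
  rewrite -cmodV; apply: (@le_supnorm R invW); apply: continuousC_inv (W1 zeta).
  by apply: expandable_continuous; exact: WE.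
(* Any point of the circle gives [1 = |W| * |1 / W| <= mu]; the point of angle 0 is used. *)
have mu1 : (1%:E <= mu)%E.
  pose zeta := expi (0 : R).
  have cw : 0 < cmod (W (val zeta)) by rewrite cmod_gt0.
  have -> : 1%:E = ((cmod (W (val zeta)))%:E * (cmod (W (val zeta)))^-1%:E)%E.
    by rewrite -EFinM divff ?gt_eqF.
  apply: lee_pmul; rewrite ?lee_fin ?invr_ge0 ?(ltW cw) //.
  by apply: le_supnorm; apply: expandable_continuous; exact: WE.
have S0 : (0 <= supnorm invW)%E.
  by apply: le_trans (invW_le (expi 0)); rewrite lee_fin invr_ge0 cmod_ge0.
have n0 : (0 <= (n%:R `^ p^-1)%:E :> \bar R)%E by rewrite lee_fin powR_ge0.
have muN u : (0 <= u)%E -> ((n%:R `^ p^-1)%:E * u <= mu * (n%:R `^ p^-1)%:E * u)%E.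
  move=> u0; apply: lee_wpmul2r => //; rewrite -[leLHS]mul1e.
  exact: lee_wpmul2r.
have main : (N BL <= gamma + mu * (n%:R `^ p^-1)%:E * N BR)%E.
  apply: ge_ereal_sup => _ /= [z Dz <-].
  have Dz' : closed_disk z by exact: ltW.
  change (garsia_term p Psi k BL z <= gamma + mu * (n%:R `^ p^-1)%:E * N BR)%E.
  rewrite garsia_term_inner //; last exact: blaschke_circle cL.
  (* The modulus of the zero-free [F] at [z] is at least its modulus at some point of the circle,
     where it equals that of [W]. *)
  have FS : ((cmod (F z))^-1%:E <= supnorm invW)%E.
    have [zeta Fz] := min_modulus FE F0 Dz'.
    apply: le_trans (invW_le zeta); rewrite lee_fin.
    have -> : W (val zeta) = F (val zeta) * J (val zeta) by exact: WF.
    rewrite cmodM (blaschke_circle cW) ?mulr1 ?(eqP (valP zeta)) //.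
    by rewrite lef_pV2 // posrE cmod_gt0 F0.
  have hW := garsia_term_factor hp kz (garsia_Psi_ge hN) WE FE
    (blaschke_circle cW) (blaschke_le1 cW) WF Dz (F0 _ Dz') FS.
  have hR := @garsia_term_inner R p Psi k BR z hPsi1 BRE (blaschke_circle cR) Dz.
  have est := @blaschke_power_estimate R p n (cmod (BL z)) (cmod (J z)) (cmod (BR z)) hp.
  rewrite !cmod_ge0 (blaschke_le1 cL) // (blaschke_le1 cW) // (blaschke_le1 cR) // in est.
  have {}est := est isT isT isT (blaschke_mul_le cL cW cR mle Dz').
  have ikz : 0 <= (k z)^-1 by rewrite invr_ge0 ltW // kz.
  apply: (@le_trans _ _ (((1 - cmod (J z) `^ p) `^ p^-1 / k z)%:E +
     (n%:R `^ p^-1)%:E * ((1 - cmod (BR z) `^ p) `^ p^-1 / k z)%:E)%E).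
    rewrite -EFinM -EFinD lee_fin mulrA -mulrDl.
    exact: ler_wpM2r.
  apply: leeD.
    by apply: (le_trans hW); apply: lee_wpmul2r => //; exact: garsia_term_le.
  apply: (@le_trans _ _ ((n%:R `^ p^-1)%:E * N BR)%E).
    by apply: lee_wpmul2l => //; rewrite -hR; exact: garsia_term_le.
  by apply: muN; exact: garsia_norm_ge0.
split=> //.
have hardyE g : (forall a, closed_disk a -> expandable g a) -> hardy p g.
  exact: hardy_closed_disk.
have [_ hL] := hC _ (hardyE _ BLE).
have [hW _] := hC _ (hardyE _ WE).
have [hR _] := hC _ (hardyE _ BRE).
have c0 : 0 <= (C1 * C2)^-1 by rewrite invr_ge0 mulr_ge0 ?ltW.
apply: (@le_trans _ _ (C1^-1%:E * N BL)%E).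
  have -> : C1^-1%:E = ((C1 * C2)^-1%:E * C2%:E)%E.
    by rewrite -EFinM invfM -mulrA mulVf ?mulr1 // gt_eqF.
  by rewrite -muleA; apply: lee_wpmul2l.
apply: (@le_trans _ _ (C1^-1%:E * (gamma + mu * (n%:R `^ p^-1)%:E * N BR))%E).
  by apply: lee_wpmul2l => //; rewrite lee_fin invr_ge0 ltW.
have NW0 := @garsia_norm_ge0 R p Psi k kz W; have NR0 := @garsia_norm_ge0 R p Psi k kz BR.
have mu0 : (0 <= mu * (n%:R `^ p^-1)%:E)%E.
  by rewrite mule_ge0 //; apply: le_trans mu1; rewrite lee_fin.
have C1K u : (0 <= u)%E -> (C1^-1%:E * (C1%:E * u) = u)%E.
  by move=> u0; rewrite muleA -EFinM mulVf ?mul1e // gt_eqF.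
have c1 : (0 <= C1^-1%:E :> \bar R)%E by rewrite lee_fin invr_ge0 ltW.
have NX g v : (N g <= C1%:E * v)%E -> (C1^-1%:E * N g <= v)%E.
  move=> h; apply: (le_trans (lee_wpmul2l c1 h)).
  by rewrite muleA -EFinM mulVf ?mul1e // gt_eqF.
have G0 : (0 <= gamma)%E by exact: mule_ge0.
have R0 : (0 <= mu * (n%:R `^ p^-1)%:E * N BR)%E by exact: mule_ge0.
(* Either summand may be [+oo], so distributivity rests on both being nonnegative. *)
rewrite (ge0_muleDr _ G0 R0); apply: leeD.
  by rewrite muleA; apply: lee_wpmul2r => //; exact: NX.
by rewrite muleCA; apply: lee_wpmul2l => //; exact: NX.
Qed.
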